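(* $mnl(K_{2,1,1,1,1,1}) = 9$.
   Context: $K_{n_1,\dots,n_k}$ denotes the complete $k$-partite graph with parts of sizes $n_1,\dots,n_k$. An embedding of a finite graph $G$ means a tame embedding of $G$ in $\mathbb{R}^3$. A link in an embedding is an unordered pair of vertex-disjoint (simple closed) cycles of $G$ whose images form a non-trivial (non-split) two-component link (no three pairwise disjoint cycles exist in the graph considered here); links are counted as pairs of cycles. $mnl(G)$ is the minimal number of links in any embedding of $G$ in $\mathbb{R}^3$. *)

(* Defs.v *)
From mathcomp Require Import all_boot all_order all_algebra.
From mathcomp Require Import all_classical all_reals all_analysis.
Import Order.TTheory GRing.Theory Num.Theory.
Import numFieldNormedType.Exports.

Set Implicit Arguments.
Unset Strict Implicit.
Unset Printing Implicit Defensive.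

Local Open Scope classical_set_scope.
Local Open Scope ring_scope.

(* A graph is an adjacency relation [e : rel 'I_n]; subgraphs without isolated
   vertices, cycles in particular, are identified with their sets of edges,
   an edge being a two-element set of vertices. *)

(* [reshape_index ns i] is the index of the block containing [i] when
   0, ..., sumn ns - 1 is cut into consecutive blocks of sizes [ns]. *)
Definition complete_multipartite (ns : seq nat) : rel 'I_(sumn ns) :=
  fun i j => reshape_index ns i != reshape_index ns j.
Arguments complete_multipartite : clear implicits.

Lemma complete_multipartite_sym ns : symmetric (complete_multipartite ns).
Proof. by move=> i j; rewrite /complete_multipartite eq_sym. Qed.

Lemma complete_multipartite_irr ns : irreflexive (complete_multipartite ns).
Proof. by move=> i; rewrite /complete_multipartite eqxx. Qed.

Definition edges_of_seq n (s : seq 'I_n) : {set {set 'I_n}} :=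
  [set [set x; next s x] | x in s]%SET.

Definition is_cycle n (e : rel 'I_n) (C : {set {set 'I_n}}) : Prop :=
  exists s : seq 'I_n, [/\ (2 < size s)%N, ucycle e s & C = edges_of_seq s].

(* The closed simplices of a graph, viewed as a complex of dimension at most
   1: its vertices and its edges. *)
Definition simplices n (e : rel 'I_n) : {set {set 'I_n}} :=
  [set [set p.1; p.2] | p : 'I_n * 'I_n & (p.1 == p.2) || e p.1 p.2]%SET.

(* Geometric realization, in barycentric coordinates. *)
Definition realization (R : realType) n (K : {set {set 'I_n}}) :
    set 'rV[R]_n :=
  [set x : 'rV[R]_n | [/\ forall i, 0 <= x ord0 i, \sum_i x ord0 i = 1 &
     exists2 S, S \in K & forall i, x ord0 i != 0 -> i \in S]].

Definition homeomorphism (T U : topologicalType) (h : T -> U) : Prop :=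
  continuous h /\
  exists g : U -> T, [/\ continuous g, cancel h g & cancel g h].

Definition segment (R : realType) (a b : 'rV[R]_3) : set 'rV[R]_3 :=
  [set (1 - t) *: a + t *: b | t in [set t : R | 0 <= t <= 1]].

Definition polygonal (R : realType) (A : set 'rV[R]_3) : Prop :=
  exists s : seq 'rV[R]_3,
    A = \bigcup_(k in [set k | (k.+1 < size s)%N]) segment s`_k s`_k.+1.

(* Only the restriction of [f] to the realization of the graph matters; since
   that is compact, a continuous injection is an embedding.  Tameness: some
   self-homeomorphism of space makes every edge a polygonal arc. *)
Definition tame_embedding (R : realType) n (e : rel 'I_n)
    (f : 'rV[R]_n -> 'rV[R]_3) : Prop :=
  [/\ {within realization (simplices e), continuous f},
      set_inj (realization (simplices e)) f &
      exists2 h : 'rV[R]_3 -> 'rV[R]_3, homeomorphism h &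
        forall i j, e i j ->
          polygonal (h @` (f @` realization [set [set i; j]]%SET))].

Definition unit_sphere (R : realType) : set 'rV[R]_3 :=
  [set x : 'rV[R]_3 | \sum_i x ord0 i ^+ 2 = 1].

Definition tame_sphere (R : realType) (S : set 'rV[R]_3) : Prop :=
  exists2 h : 'rV[R]_3 -> 'rV[R]_3, homeomorphism h &
    S = h @` (@unit_sphere R).

(* The two components lie in different components of the complement of an
   embedded 2-sphere. *)
Definition split_link (R : realType) (L M : set 'rV[R]_3) : Prop :=
  exists S : set 'rV[R]_3,
    [/\ tame_sphere S, L `<=` ~` S, M `<=` ~` S &
      forall x y, L x -> M y -> ~ connected_component (~` S) x y].

(* [P] is an unordered pair of cycles; [finset.cover C] is the vertex set of [C]. *)
Definition is_link (R : realType) n (e : rel 'I_n)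
    (f : 'rV[R]_n -> 'rV[R]_3) (P : {set {set {set 'I_n}}}) : Prop :=
  exists C D : {set {set 'I_n}},
    [/\ is_cycle e C, is_cycle e D, (finset.cover C :&: finset.cover D)%SET = finset.set0,
        P = [set C; D]%SET &
        ~ split_link (f @` realization C) (f @` realization D)].

Definition link_count (R : realType) n (e : rel 'I_n)
    (f : 'rV[R]_n -> 'rV[R]_3) : nat :=
  #|[set P : {set {set {set 'I_n}}} | `[< is_link e f P >]]%SET|.

(* The default 0 is irrelevant: every finite graph has a tame embedding, so
   the minimum exists. *)
Definition mnl (R : realType) n (e : rel 'I_n) : nat :=
  xget 0%N [set m : nat |
    (exists2 f : 'rV[R]_n -> 'rV[R]_3, tame_embedding e f &
       link_count e f = m) /\
    (forall f : 'rV[R]_n -> 'rV[R]_3, tame_embedding e f ->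
       (m <= link_count e f)%N)].

(* Main.v *)
Require Import Defs.
From mathcomp Require Import all_boot all_order all_algebra.
From mathcomp Require Import all_classical all_reals all_analysis.
From mathcomp Require Import ring lra zify.
From mathcomp Require finmap.
Import Order.TTheory GRing.Theory Num.Theory.
Import numFieldNormedType.Exports.

Set Implicit Arguments.
Unset Strict Implicit.
Unset Printing Implicit Defensive.

Local Open Scope ring_scope.

(** The graph is K_7 without the edge joining the vertices 0 and 1.

    _At least nine links._ Linking is detected modulo two. An embedding of the
    graph is approximated by a polygonal one whose vertices are in general
    position, and the linking number of two disjoint polygons is computed by
    coning one of them from an apex and counting, through signs of
    determinants, the passages of the other one through the triangles of the
    cone ([lk]). Everything needed about it follows from one exchange law for
    six points ([hit_exchange]), a statement about vectors in the plane after
    Gale duality: it is symmetric, and adding the boundary of a triangle that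
    the other polygon misses does not change it ([lk_sym], [lk_triangle]).

    If a tame sphere separates two disjoint curves, one of them lies on the
    bounded side; pulled back to the round ball it shrinks to a point, away
    from the other curve, through polygons that differ by small triangles. So
    the linking number of a fine enough approximation is zero
    ([contracted_unlinked]), and an odd linking number certifies a link.

    As in the theorem of Conway and Gordon, some sums of linking numbers do not
    depend on the embedding: moving the edges of the graph changes the linking
    number of two cycles by a sum, over the pairs of an edge of each, of a
    symmetric quantity, which disappears from the total over a family of pairs
    of cycles covering each pair of edges evenly ([lk_even_cover]). The total
    is then read off the moment curve. Two copies of K_6, the twenty copies of
    K_{3,3,1} and four more families of this kind leave room for no fewer than
    nine odd linking numbers ([nine_by_parity], [nine_odd_pairs]).

    _At most nine links._ Take straight edges between seven suitable points. For
    all pairs of disjoint cycles but nine, one of the two cycles bounds a fan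
    of at most two triangles which the other one misses. A fan is compact and
    star-shaped, and the boundary of a thin neighbourhood of a compact
    star-shaped set is a tame sphere, because radial projection from the centre
    extends to a homeomorphism of space ([split_star_shaped], [fan_split]). *)

(** * Vectors in the plane *)

Lemma big_addb_unique (I : finType) (P : pred I) :
  (forall i j, P i -> P j -> i = j) ->
  \big[addb/false]_i P i = [exists i, P i].
Proof.
move=> uP; case: (pickP P) => [i Pi | P0].
  rewrite (bigD1 i) //= Pi big1 => [|j]; last first.
    by apply: contraNF => /uP/(_ Pi)->.
  by symmetry; apply/existsP; exists i.
by rewrite big1 => [|j _]; [symmetry; apply/existsP => -[i]; rewrite P0 | rewrite P0].
Qed.

Section OneSided.
Variables (F : realFieldType) (n : nat).
Implicit Types u w : 'I_n.+2 -> F.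

Definition wedge u w i j : F := u i * w j - u j * w i.

Definition all_left u w i := [forall j, (j != i) ==> (0 < wedge u w i j)].

Definition all_right u w i := [forall j, (j != i) ==> (wedge u w i j < 0)].

Lemma all_left_unique u w i j : all_left u w i -> all_left u w j -> i = j.
Proof.
move=> /forallP/(_ j)/implyP Li /forallP/(_ i)/implyP Lj.
apply/eqP/negPn/negP => ij; move: (Li) (Lj); rewrite eq_sym ij => /(_ isT) Pi /(_ isT).
by apply/negP; rewrite -leNgt; move: Pi; rewrite /wedge; lra.
Qed.

Lemma all_right_wedgeN u w : all_right u w =1 all_left u (fun i => - w i).
Proof.
move=> i; apply: eq_forallb => j; rewrite /wedge; congr (_ ==> _).
by apply/idP/idP; lra.
Qed.

(** Vectors strictly on the left of [u s, w s] are linearly ordered by the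
    angle they make with it, and the last of them has all the others on its
    right; the quotient minimized below is the cotangent of that angle. *)
Lemma all_left_right u w s :
  (forall i j, i != j -> wedge u w i j != 0) ->
  all_left u w s -> exists j, all_right u w j.
Proof.
move=> dN0 /forallP Ls.
have {}Ls j : j != s -> 0 < wedge u w s j by move=> js; move: (Ls j); rewrite js.
have [j0 j0s] : exists j0, j0 != s.
  exists (if s == ord0 then ord_max else ord0).
  by case: (eqVneq s ord0) => [->|] //; rewrite eq_sym.
case: (@arg_minP _ _ _ _ (fun j => j != s) (fun j => (u s * u j + w s * w j) / wedge u w s
  j) j0s) => j js jmin.
exists j; apply/forallP => k; apply/implyP => kj.
case: (eqVneq k s) => [->|ks]; first by move: (Ls j js); rewrite /wedge; lra.
have := jmin k ks; rewrite ler_pdivrMr ?Ls// mulrAC ler_pdivlMr ?Ls// => le.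
rewrite lt_neqAle dN0 1?eq_sym//=; move: (Ls j js) (Ls k ks) => Lj Lk.
have s2 : 0 < u s ^+ 2 + w s ^+ 2.
  rewrite lt_neqAle addr_ge0 ?sqr_ge0// andbT eq_sym paddr_eq0 ?sqr_ge0// !sqrf_eq0.
  by apply/negP => /andP[/eqP us /eqP ws]; move: Lj; rewrite /wedge us ws; lra.
rewrite -(pmulr_rle0 _ s2).
have -> : (u s ^+ 2 + w s ^+ 2) * wedge u w j k =
   (u s * u j + w s * w j) * wedge u w s k - (u s * u k + w s * w k) * wedge u w s j.
  by rewrite /wedge; ring.
by rewrite subr_le0.
Qed.

(** There is a vector with all the others on its left exactly when there is one
    with all the others on its right: both happen when the vectors lie in an open
    half-plane. So the number counted here is 0 or 2. *)
Lemma one_sided_even u w :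
  (forall i j, i != j -> wedge u w i j != 0) ->
  \big[addb/false]_i (all_left u w i || all_right u w i) = false.
Proof.
move=> dN0.
have excl i : all_left u w i || all_right u w i = all_left u w i (+) all_right u w i.
  case: (boolP (all_left u w i)) => // /forallP L; case: (boolP (all_right u w i)) =>
    // /forallP.
  have [j ji] : exists j, j != i.
    exists (if i == ord0 then ord_max else ord0).
    by case: (eqVneq i ord0) => [->|] //; rewrite eq_sym.
  by move=> /(_ j); move: (L j); rewrite ji /=; lra.
under eq_bigr do rewrite excl.
rewrite big_split/=.
under [X in _ (+) X]eq_bigr do rewrite all_right_wedgeN.
rewrite !big_addb_unique => [||]; try by move=> i j; apply: all_left_unique.
suff -> : [exists i, all_left u w i] = [exists i, all_left u (fun i => - w i) i].
  by rewrite addbb.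
apply/idP/idP => /existsP[s].
  by move=> /(all_left_right dN0) [j]; rewrite all_right_wedgeN => Rj; apply/existsP;
    exists j.
move=> /all_left_right[|j].
  by move=> i j /dN0; rewrite /wedge; apply: contra_neq; lra.
rewrite all_right_wedgeN => Lj; apply/existsP; exists j.
by move: Lj; rewrite /all_left; under eq_forallb do rewrite /wedge !opprK.
Qed.

End OneSided.

(** * Segments meeting triangles *)

Notation o0 := (@Ordinal 3 0 isT).
Notation o1 := (@Ordinal 3 1 isT).
Notation o2 := (@Ordinal 3 2 isT).

(** Six times the signed volume of a tetrahedron. It is spelled out, rather than
    written as a determinant, to be within reach of [ring]; polynomial and integer
    entries occur as well as real ones. *)
Definition vol (K : comNzRingType) (a b c d : 'rV[K]_3) : K :=
  let x i := b ord0 i - a ord0 i in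
  let y i := c ord0 i - a ord0 i in
  let z i := d ord0 i - a ord0 i in
  x o0 * (y o1 * z o2 - y o2 * z o1) - x o1 * (y o0 * z o2 - y o2 * z o0)
  + x o2 * (y o0 * z o1 - y o1 * z o0).

Section Hit.
Variable F : realFieldType.
Implicit Types a b c d e p u v : 'rV[F]_3.

(** The affine dependency between five points, with the signs of [d] and [e]
    changed: see [dependency_sum] and [dependency_weights]. *)
Definition dependency a b c d e : seq F :=
  [:: vol b c d e; - vol a c d e; vol a b d e; vol a b c e; - vol a b c d].

Definition same_sign (s : seq F) : bool :=
  all (fun x => 0 < x) s || all (fun x => x < 0) s.

(** The triangle [a b c] meets the segment [d e] at an interior point of both: the
    dependency between the five points can be read as the equality of a convex
    combination of the first three with one of the last two. *)
Definition hit a b c d e : bool := same_sign (dependency a b c d e).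

Definition generic (T : eqType) (P : T -> 'rV[F]_3) :=
  forall x y z t, uniq [:: x; y; z; t] -> vol (P x) (P y) (P z) (P t) != 0.

(** If the vectors [(u i, w i)] are the coordinates of a basis of the dependencies
    between six points, then [wedge u w i] is, up to a scalar, the dependency that
    omits the [i]-th point. *)
Lemma one_sided_row (u w : 'I_6 -> F) i (C : F) (s : seq F) :
  C != 0 -> size s = 5%N ->
  (forall k : 'I_5, wedge u w i (lift i k) = C * s`_k) ->
  all_left u w i || all_right u w i = same_sign s.
Proof.
move=> C0 s5 Es.
have lifts (Q : pred F) : [forall j, (j != i) ==> Q (wedge u w i j)] =
    all (fun x => Q (C * x)) s.
  apply/forallP/(all_nthP 0) => [H k|H j].
    by rewrite s5 => k5; have := H (lift i (Ordinal k5)); rewrite eq_sym neq_lift Es.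
  by apply/implyP; rewrite eq_sym => /unlift_some[k -> _]; rewrite Es; apply: H; rewrite s5.
rewrite /all_left /all_right (lifts (fun x => 0 < x)) (lifts (fun x => x < 0)) /same_sign.
have [Cp|Cn|Ce] := ltgtP 0 C.
- by congr orb; apply: eq_all => x; rewrite ?pmulr_rgt0 ?pmulr_rlt0.
- by rewrite orbC; congr orb; apply: eq_all => x; rewrite ?nmulr_rgt0 ?nmulr_rlt0.
- by rewrite -Ce eqxx in C0.
Qed.

Lemma addb_ord6 (G : pred 'I_6) : \big[addb/false]_i G i =
  G (@Ordinal 6 0 isT) (+) G (@Ordinal 6 1 isT) (+) G (@Ordinal 6 2 isT) (+)
  G (@Ordinal 6 3 isT) (+) G (@Ordinal 6 4 isT) (+) G (@Ordinal 6 5 isT).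
Proof.
rewrite !big_ord_recl big_ord0 addbF !addbA.
by do ![congr addb | congr G; apply: val_inj].
Qed.

(** Two triangles in general position cross the boundaries of each other an even
    number of times in all, since they intersect in a segment, if at all. The proof
    is by Gale duality: the dependencies between six points form a plane; once the
    signs of [u], [v] and [p] are changed, each of the six crossings says that the
    row of one point in a basis of that plane has all the other rows on one side, and
    [one_sided_even] applies. *)
Lemma hit_exchange (T : eqType) (P : T -> 'rV[F]_3) (i j k l m n : T) :
  generic P -> uniq [:: i; j; k; l; m; n] ->
  let a := P i in let b := P j in let c := P k in
  let u := P l in let v := P m in let p := P n in
  hit a b c u v (+) hit a b c u p (+) hit a b c v p =
  hit u v p a b (+) hit u v p a c (+) hit u v p b c.
Proof.
move=> gP uq a b c u v p.
(* A basis of the dependencies: those that omit [p] and [v]. *)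
pose X := [:: vol b c u v; - vol a c u v; vol a b u v; vol a b c v; - vol a b c u; 0].
pose Y := [:: vol b c u p; - vol a c u p; vol a b u p; vol a b c p; 0; - vol a b c u].
pose x (i : 'I_6) := X`_i; pose y (i : 'I_6) := Y`_i.
have : all (fun x => x != 0) [:: vol a b c u; vol a b c v; vol a b c p;
   vol a b u v; vol a b u p; vol a b v p; vol a c u v; vol a c u p; vol a c v p;
     vol a u v p;
   vol b c u v; vol b c u p; vol b c v p; vol b u v p; vol c u v p].
  move: uq; rewrite /= !inE !negb_or !andbT; do ![case/andP | move=> ?].
  by rewrite !gP//= !inE !negb_or !andbT; repeat (apply/andP; split => //).
rewrite /= andbT; do ![case/andP | move=> ?].
have row i0 (s : seq F) C : size s = 5%N -> C != 0 -> all (fun x => x != 0) s ->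
    (forall k : 'I_5, wedge x y i0 (lift i0 k) = C * s`_k) ->
  all_left x y i0 || all_right x y i0 = same_sign s /\ (forall j, i0 != j ->
    wedge x y i0 j != 0).
  move=> s5 C0 /(all_nthP 0) s0 Es; split; first exact: one_sided_row Es.
  by move=> q /unlift_some[k0 -> _]; rewrite Es mulf_neq0 ?s0 ?s5.
have [||| r0 n0] := @row (@Ordinal 6 0 isT) [:: vol c u v p; - vol b u v p; - vol b c v p;
  vol b c u p; - vol b c u v]
    (vol a b c u) erefl.
- by rewrite ?oppr_eq0.
- by rewrite /= ?oppr_eq0; repeat (apply/andP; split => //).
- by case; do 5?[case] => //= hk; rewrite /wedge /x /y /X /Y/= /vol; ring.
have [||| r1 n1] := @row (@Ordinal 6 1 isT) [:: vol c u v p; - vol a u v p; - vol a c v p;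
  vol a c u p; - vol a c u v]
    (- vol a b c u) erefl.
- by rewrite ?oppr_eq0.
- by rewrite /= ?oppr_eq0; repeat (apply/andP; split => //).
- by case; do 5?[case] => //= hk; rewrite /wedge /x /y /X /Y/= /vol; ring.
have [||| r2 n2] := @row (@Ordinal 6 2 isT) [:: vol b u v p; - vol a u v p; - vol a b v p;
  vol a b u p; - vol a b u v]
    (vol a b c u) erefl.
- by rewrite ?oppr_eq0.
- by rewrite /= ?oppr_eq0; repeat (apply/andP; split => //).
- by case; do 5?[case] => //= hk; rewrite /wedge /x /y /X /Y/= /vol; ring.
have [||| r3 n3] := @row (@Ordinal 6 3 isT) (dependency a b c v p)
    (vol a b c u) erefl.
- by rewrite ?oppr_eq0.
- by rewrite /= ?oppr_eq0; repeat (apply/andP; split => //).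
- by case; do 5?[case] => //= hk; rewrite /wedge /x /y /X /Y/= /vol; ring.
have [||| r4 n4] := @row (@Ordinal 6 4 isT) (dependency a b c u p)
    (- vol a b c u) erefl.
- by rewrite ?oppr_eq0.
- by rewrite /= ?oppr_eq0; repeat (apply/andP; split => //).
- by case; do 5?[case] => //= hk; rewrite /wedge /x /y /X /Y/= /vol; ring.
have [||| r5 n5] := @row (@Ordinal 6 5 isT) (dependency a b c u v)
    (vol a b c u) erefl.
- by rewrite ?oppr_eq0.
- by rewrite /= ?oppr_eq0; repeat (apply/andP; split => //).
- by case; do 5?[case] => //= hk; rewrite /wedge /x /y /X /Y/= /vol; ring.
have even : \big[addb/false]_i (all_left x y i || all_right x y i) = false.
  apply: one_sided_even => i' j'.
  by case: i' => -[|[|[|[|[|[|//]]]]]] hi ij;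
    [apply: n0|apply: n1|apply: n2|apply: n3|apply: n4|apply: n5];
    apply: contra_neq ij => <-; apply: val_inj.
rewrite addb_ord6 in even.
have {r0}-> : hit u v p b c = all_left x y (@Ordinal 6 0 isT) ||
    all_right x y (@Ordinal 6 0 isT).
  rewrite r0 /hit /dependency.
  have -> : vol v p b c = vol b c v p by rewrite /vol; ring.
  have -> : vol u p b c = vol b c u p by rewrite /vol; ring.
  have -> : vol u v b c = vol b c u v by rewrite /vol; ring.
  have -> : vol u v p c = - vol c u v p by rewrite /vol; ring.
  have -> : vol u v p b = - vol b u v p by rewrite /vol; ring.
  by rewrite /same_sign /= ?opprK ?oppr_gt0 ?oppr_lt0; do 10?[case: (_ < _) => //=].
have {r1}-> : hit u v p a c = all_left x y (@Ordinal 6 1 isT) ||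
    all_right x y (@Ordinal 6 1 isT).
  rewrite r1 /hit /dependency.
  have -> : vol v p a c = vol a c v p by rewrite /vol; ring.
  have -> : vol u p a c = vol a c u p by rewrite /vol; ring.
  have -> : vol u v a c = vol a c u v by rewrite /vol; ring.
  have -> : vol u v p c = - vol c u v p by rewrite /vol; ring.
  have -> : vol u v p a = - vol a u v p by rewrite /vol; ring.
  by rewrite /same_sign /= ?opprK ?oppr_gt0 ?oppr_lt0; do 10?[case: (_ < _) => //=].
have {r2}-> : hit u v p a b = all_left x y (@Ordinal 6 2 isT) ||
    all_right x y (@Ordinal 6 2 isT).
  rewrite r2 /hit /dependency.
  have -> : vol v p a b = vol a b v p by rewrite /vol; ring.
  have -> : vol u p a b = vol a b u p by rewrite /vol; ring.
  have -> : vol u v a b = vol a b u v by rewrite /vol; ring.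
  have -> : vol u v p b = - vol b u v p by rewrite /vol; ring.
  have -> : vol u v p a = - vol a u v p by rewrite /vol; ring.
  by rewrite /same_sign /= ?opprK ?oppr_gt0 ?oppr_lt0; do 10?[case: (_ < _) => //=].
rewrite /hit -{}r5 -{}r4 -{}r3.
move: even; do 6!case: (_ || _) => //.
Qed.

End Hit.

(** * Linking numbers modulo two *)

Section Chains.
Variable T : eqType.
Implicit Types (c d : seq (T * T)).

(** A chain modulo two is a list of segments, and its boundary vanishes when every
    point is an end of an even number of them; testing against all functions gives
    this in the form in which it is used. *)
Definition closed_chain c :=
  forall g : T -> bool, \big[addb/false]_(s <- c) (g s.1 (+) g s.2) = false.

Definition apart c d :=
  forall s t, s \in c -> t \in d -> uniq [:: s.1; s.2; t.1; t.2].

Definition avoids (l : seq T) c :=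
  forall s, s \in c -> (s.1 \notin l) && (s.2 \notin l).

Definition triangle_chain (i j k : T) := [:: (i, j); (i, k); (j, k)].

Lemma closed_triangle i j k : closed_chain (triangle_chain i j k).
Proof.
by move=> g; rewrite !big_cons big_nil /=; case: (g i); case: (g j); case: (g k).
Qed.

Lemma apart_sym c d : apart c d -> apart d c.
Proof.
by move=> cd s t sd tc; rewrite -(rot_uniq 2) /=; apply: cd.
Qed.

End Chains.

Section Linking.
Variables (F : realFieldType) (T : eqType) (P : T -> 'rV[F]_3).
Hypothesis genP : generic P.
Implicit Types (c d : seq (T * T)).

Definition hits p (s t : T * T) := hit (P s.1) (P s.2) (P p) (P t.1) (P t.2).

(** The parity of the number of passages of [d] through the cone over [c] with apex
    [p]. *)
Definition lk p c d :=
  \big[addb/false]_(s <- c) \big[addb/false]_(t <- d) hits p s t.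

(** Coning [c] from [p] fills it with triangles, coning [d] from [q] fills it
    too, and for each pair of such triangles the exchange lemma trades the
    passages of one boundary through the other triangle. The sides through the
    apexes cancel since the chains are closed. *)
Lemma lk_swap p q c d : p != q -> closed_chain c -> closed_chain d ->
  apart c d -> avoids [:: p; q] c -> avoids [:: p; q] d -> lk p c d = lk q d c.
Proof.
move=> pq cc cd acd ac ad.
pose G s t := hits p s t (+) hit (P s.1) (P s.2) (P p) (P t.1) (P q)
  (+) hit (P s.1) (P s.2) (P p) (P t.2) (P q).
pose H s t := hits q t s (+) hit (P t.1) (P t.2) (P q) (P s.1) (P p)
  (+) hit (P t.1) (P t.2) (P q) (P s.2) (P p).
have -> : lk p c d = \big[addb/false]_(s <- c) \big[addb/false]_(t <- d) G s t.
  apply: eq_bigr => s _; under [RHS]eq_bigr do rewrite /G -addbA.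
  by rewrite big_split /= (cd (fun x => hit (P s.1) (P s.2) (P p) (P x) (P q))) addbF.
have -> : lk q d c = \big[addb/false]_(t <- d) \big[addb/false]_(s <- c) H s t.
  apply: eq_bigr => t _; under [RHS]eq_bigr do rewrite /H -addbA.
  by rewrite big_split /= (cc (fun x => hit (P t.1) (P t.2) (P q) (P x) (P p))) addbF.
rewrite exchange_big; apply: eq_big_seq => t td; apply: eq_big_seq => s sc.
rewrite /G /H /hits.
apply: (@hit_exchange _ _ _ s.1 s.2 p t.1 t.2 q genP).
move: (acd s t sc td) (ac s sc) (ad t td) pq.
rewrite /= !inE !negb_or !andbT (eq_sym s.1 p) (eq_sym s.2 p) (eq_sym t.1 p) (eq_sym t.2 p).
do ![case/andP | move=> ?]; repeat (apply/andP; split => //).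
all: by rewrite eq_sym.
Qed.

Variables (p q r : T).
Hypothesis pqr : uniq [:: p; q; r].

Lemma avoids_sub l l' c : {subset l' <= l} -> avoids l c -> avoids l' c.
Proof.
move=> sl al s /al /andP[h1 h2].
by apply/andP; split; [apply: contra h1|apply: contra h2]; apply: sl.
Qed.

(** [lk_swap] three times, through the apexes [q], [r] and [p]. *)
Lemma lk_sym c d : closed_chain c -> closed_chain d -> apart c d ->
  avoids [:: p; q; r] c -> avoids [:: p; q; r] d -> lk p c d = lk p d c.
Proof.
move: pqr; rewrite /= !inE negb_or !andbT => /andP[/andP[pq pr] qr] cc cd acd ac ad.
have sub a b : a \in [:: p; q; r] -> b \in [:: p; q; r] -> {subset [:: a; b] <= [:: p; q;
  r]}.
  by move=> ha hb x; rewrite in_cons mem_seq1 => /orP[]/eqP->.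
have avs a b e : a \in [:: p; q; r] -> b \in [:: p; q; r] -> avoids [:: p; q; r] e ->
  avoids [:: a; b] e.
  by move=> ha hb; apply: avoids_sub; apply: sub.
rewrite (@lk_swap p q)//; try by apply: avs => //; rewrite !inE eqxx ?orbT.
rewrite (@lk_swap q r)//; try (exact: apart_sym); try by apply: avs => //;
  rewrite !inE eqxx ?orbT.
rewrite (@lk_swap r p)//; try (by rewrite eq_sym); try by apply: avs => //;
  rewrite !inE eqxx ?orbT.
Qed.

(** For the boundary of a triangle the cone may be replaced by the triangle itself. *)
Lemma lk_triangle i j k d : closed_chain d -> apart (triangle_chain i j k) d ->
  avoids [:: p; q; r] (triangle_chain i j k) -> avoids [:: p; q; r] d ->
  lk p (triangle_chain i j k) d =
  \big[addb/false]_(t <- d) hit (P i) (P j) (P k) (P t.1) (P t.2).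
Proof.
move=> cd acd ac ad.
have pq : p != q by move: pqr; rewrite /= !inE negb_or => /andP[/andP[]].
have sub : {subset [:: p; q] <= [:: p; q; r]}.
  by move=> x; rewrite !inE => /orP[]/eqP->; rewrite eqxx ?orbT.
rewrite (@lk_swap p q) //; [|exact: closed_triangle|exact: avoids_sub ac|exact: avoids_sub
  ad].
transitivity (\big[addb/false]_(t <- d) (hit (P i) (P j) (P k) (P t.1) (P t.2) (+)
  (hit (P i) (P j) (P k) (P t.1) (P q) (+) hit (P i) (P j) (P k) (P t.2) (P q))));
    last first.
  by rewrite big_split /= (cd (fun x => hit (P i) (P j) (P k) (P x) (P q))) addbF.
apply: eq_big_seq => t td; rewrite !big_cons big_nil addbF !addbA /hits /=; symmetry.
apply: (@hit_exchange _ _ _ i j k t.1 t.2 q genP).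
have [hij hik hjk] : [/\ (i, j) \in triangle_chain i j k,
    (i, k) \in triangle_chain i j k & (j, k) \in triangle_chain i j k].
  by rewrite /triangle_chain !inE !eqxx ?orbT.
move: (acd _ t hij td) (acd _ t hik td) (acd _ t hjk td) (ac _ hij) (ac _ hjk) (ad t td).
rewrite /= !inE !negb_or !andbT.
do ![case/andP | move=> ?]; repeat (apply/andP; split => //).
Qed.
End Linking.

(** * Parities that do not depend on the embedding *)

Definition edge := (nat * nat)%type.

Definition ordered_edge (x y : nat) : edge := if (x <= y)%N then (x, y) else (y, x).

Definition cycle_edges (s : seq nat) : seq edge :=
  [seq ordered_edge x (next s x) | x <- s].

Lemma ordered_edge_sum (g : nat -> bool) x y :
  g (ordered_edge x y).1 (+) g (ordered_edge x y).2 = g x (+) g y.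
Proof. by rewrite /ordered_edge; case: ifP => //= _; rewrite addbC. Qed.

Lemma perm_next (U : eqType) (s : seq U) : uniq s -> perm_eq (map (next s) s) s.
Proof.
move=> us; apply: uniq_perm => //.
  by rewrite map_inj_uniq//; apply: can_inj (prev_next us).
move=> x; apply/mapP/idP => [[y ys ->]|xs]; first by rewrite mem_next.
by exists (prev s x); rewrite ?mem_prev ?next_prev.
Qed.

Lemma cycle_edges_closed (s : seq nat) (g : nat -> bool) : uniq s ->
  \big[addb/false]_(e <- cycle_edges s) (g e.1 (+) g e.2) = false.
Proof.
move=> us; rewrite big_map; under eq_bigr do rewrite ordered_edge_sum.
rewrite big_split/= -(big_map (next s) predT g).
by rewrite (perm_big _ (perm_next us)) addbb.
Qed.

Lemma cycle_edges_mem s e : e \in cycle_edges s -> (e.1 \in s) && (e.2 \in s).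
Proof.
case/mapP => x xs ->; rewrite /ordered_edge.
by case: ifP => _ /=; rewrite mem_next xs.
Qed.

Lemma cycle_edges_neq s e : uniq s -> (1 < size s)%N -> e \in cycle_edges s -> e.1 != e.2.
Proof.
move=> us s1 /mapP[x xs ->]; rewrite /ordered_edge.
suff: x != next s x by case: ifP => //= _; rewrite eq_sym.
case/rot_to: xs => i p sE; rewrite -(next_rot i us) sE.
move: us s1; rewrite -(rot_uniq i) -(size_rot i) sE.
by case: p {sE} => [|y p] //=; rewrite eqxx !inE !negb_or => /andP[/andP[]].
Qed.

Lemma big_addb_even (A : eqType) (W : seq A) (G : A -> bool) :
  all (fun w => ~~ odd (count_mem w W)) W -> \big[addb/false]_(w <- W) G w = false.
Proof.
move=> /allP ev; rewrite -big_undup_iterop_count big1_seq // => w /andP[_].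
rewrite mem_undup => /ev; have iterop_addb n b : iterop n addb b false = odd n && b.
  case: n => //= n; elim: n => [|n IH] /=; first by [].
  by rewrite IH; case: (odd n) => /=; rewrite ?addbb ?addbF.
by rewrite iterop_addb => /negbTE ->.
Qed.

(** The weights order the edges with ends below 8, which is all that matters to
    forget the order of two of them. *)
Definition sorted_pair (w : edge * edge) : edge * edge :=
  let key (e : edge) := (e.1 + 8 * e.2)%N in
  if (key w.1 <= key w.2)%N then w else (w.2, w.1).

Definition edge_pairs (st : seq nat * seq nat) : seq (edge * edge) :=
  [seq (e, f) | e <- cycle_edges st.1, f <- cycle_edges st.2].

(** Every unordered pair of edges lies in evenly many of the listed pairs of
    cycles, with one edge in each cycle. *)
Definition even_cover (S : seq (seq nat * seq nat)) : bool :=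
  let W := [seq sorted_pair w | w <- flatten [seq edge_pairs st | st <- S]] in
  all (fun w => ~~ odd (count_mem w W)) W.

Section Parity.
Variables (F : realFieldType) (T : eqType) (P : T -> 'rV[F]_3).
Hypothesis genP : generic P.
Variables (p q r : T).
Hypothesis pqr : uniq [:: p; q; r].
Variables (va ba : nat -> T) (ch : edge -> seq (T * T)).
Hypothesis chE : forall e (g : T -> bool),
  \big[addb/false]_(s <- ch e) (g s.1 (+) g s.2) = g (va e.1) (+) g (va e.2).

Definition base_seg (e : edge) := (ba e.1, ba e.2).

(** The closed chain by which a path of the graph differs from the straight segment
    of the reference drawing, the corresponding vertices being joined. *)
Definition loop (e : edge) : seq (T * T) :=
  ch e ++ [:: base_seg e; (va e.1, ba e.1); (va e.2, ba e.2)].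

Variable dom : pred nat.
Hypothesis loop_apart : forall e f, uniq [:: e.1; e.2; f.1; f.2] ->
  all dom [:: e.1; e.2; f.1; f.2] -> apart (loop e) (loop f).
Hypothesis loop_avoids : forall e, dom e.1 -> dom e.2 -> avoids [:: p; q; r] (loop e).

Definition path_cycle (s : seq nat) := flatten [seq ch e | e <- cycle_edges s].
Definition base_cycle (s : seq nat) := [seq base_seg e | e <- cycle_edges s].

Lemma closed_loop e : closed_chain (loop e).
Proof.
move=> g; rewrite big_cat chE !big_cons big_nil /=.
by case: (g (va e.1)); case: (g (va e.2)); case: (g (ba e.1)); case: (g (ba e.2)).
Qed.

Lemma closed_base_cycle s : uniq s -> closed_chain (base_cycle s).
Proof.
by move=> us g; rewrite big_map (cycle_edges_closed (fun x => g (ba x)) us).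
Qed.

Lemma closed_path_cycle s : uniq s -> closed_chain (path_cycle s).
Proof.
move=> us g; rewrite /path_cycle big_flatten big_map; under eq_bigr do rewrite chE.
exact: (cycle_edges_closed (fun x => g (va x)) us).
Qed.

(** Each vertex of a cycle belongs to two of its edges, so that the segments joining
    corresponding vertices cancel. *)
Lemma sum_loops s (phi : T * T -> bool) : uniq s ->
  \big[addb/false]_(e <- cycle_edges s) \big[addb/false]_(x <- loop e) phi x =
  \big[addb/false]_(x <- path_cycle s) phi x (+) \big[addb/false]_(x <- base_cycle s) phi x.
Proof.
move=> us; under eq_bigr do rewrite big_cat !big_cons big_nil /= addbF.
rewrite big_split big_split /= (cycle_edges_closed (fun x => phi (va x, ba x)) us) addbF.
by rewrite /path_cycle /base_cycle big_flatten !big_map.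
Qed.

Let lkp := lk P p.

Lemma lk_big (I : Type) (l : seq I) (c : seq (T * T)) (D : I -> seq (T * T)) :
  lkp c (flatten [seq D i | i <- l]) = \big[addb/false]_(i <- l) lkp c (D i).
Proof.
by rewrite /lkp /lk exchange_big big_flatten big_map; apply: eq_bigr => i _;
  rewrite exchange_big.
Qed.

(** The contribution of a pair of edges to the change of linking numbers. *)
Definition correction (w : edge * edge) :=
  lkp (loop w.1) [:: base_seg w.2] (+) lkp (loop w.2) [:: base_seg w.1]
  (+) lkp (loop w.1) (loop w.2).

Lemma uniq_cross s t e f : uniq (s ++ t) -> (1 < size s)%N -> (1 < size t)%N ->
  e \in cycle_edges s -> f \in cycle_edges t -> uniq [:: e.1; e.2; f.1; f.2].
Proof.
rewrite cat_uniq => /and3P[us st ut] s1 t1 es ft.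
have e12 := cycle_edges_neq us s1 es; have f12 := cycle_edges_neq ut t1 ft.
case/andP: (cycle_edges_mem es) => es1 es2; case/andP: (cycle_edges_mem ft) => ft1 ft2.
have dj x y : x \in s -> y \in t -> x != y.
  by move=> xs yt; apply: contraNneq st => xy; apply/hasP; exists y; rewrite // -xy.
by rewrite /= !inE !negb_or e12 f12 !dj.
Qed.

Lemma base_seg_loop e x : x \in [:: base_seg e] -> x \in loop e.
Proof. by rewrite mem_seq1 mem_cat inE => ->; rewrite orbT. Qed.

Lemma base_cycle_loop s x : x \in base_cycle s ->
  exists2 e, e \in cycle_edges s & x \in loop e.
Proof. by case/mapP => e es ->; exists e => //; apply: base_seg_loop; rewrite mem_seq1. Qed.

Lemma cycle_edges_dom s e : all dom s -> e \in cycle_edges s -> dom e.1 /\ dom e.2.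
Proof. by move=> /allP ds /cycle_edges_mem/andP[/ds ? /ds]. Qed.

(** Both curves are moved one after the other, edge by edge; this is bilinearity of
    the linking number, with [lk_sym] to exchange the two curves in the terms where
    only the second one has moved. *)
Lemma lk_correction s t : all dom s -> all dom t -> uniq (s ++ t) -> (1 < size s)%N ->
  (1 < size t)%N ->
  lkp (path_cycle s) (path_cycle t) (+) lkp (base_cycle s) (base_cycle t) =
  \big[addb/false]_(w <- edge_pairs (s, t)) correction w.
Proof.
move=> ds dt ust s1 t1; have := ust; rewrite cat_uniq => /and3P[us _ ut].
have base_flat u : base_cycle u = flatten [seq [:: base_seg e] | e <- cycle_edges u].
  by rewrite flatten_map1.
have stepl X : lkp (path_cycle s) X (+) lkp (base_cycle s) X =
    \big[addb/false]_(e <- cycle_edges s) lkp (loop e) X.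
  exact/esym/sum_loops.
have stepr X : lkp X (path_cycle t) (+) lkp X (base_cycle t) =
    \big[addb/false]_(f <- cycle_edges t) lkp X (loop f).
  rewrite -lk_big /lkp /lk -big_split; apply: eq_bigr => x _.
  by rewrite [RHS]big_flatten [RHS]big_map sum_loops.
have -> : lkp (path_cycle s) (path_cycle t) (+) lkp (base_cycle s) (base_cycle t) =
    lkp (path_cycle s) (path_cycle t) (+) lkp (base_cycle s) (path_cycle t)
    (+) (lkp (base_cycle s) (path_cycle t) (+) lkp (base_cycle s) (base_cycle t)).
  by case: (lkp _ _) => //; case: (lkp _ _) => //; case: (lkp _ _).
rewrite stepl stepr.
have -> : \big[addb/false]_(f <- cycle_edges t) lkp (base_cycle s) (loop f) =
    \big[addb/false]_(f <- cycle_edges t) \big[addb/false]_(e <- cycle_edges s)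
      lkp (loop f) [:: base_seg e].
  apply: eq_big_seq => f ft; rewrite -lk_big -base_flat.
  apply: (lk_sym genP pqr) => //.
  - exact: closed_base_cycle.
  - exact: closed_loop.
  - move=> x y /base_cycle_loop[e es xe]; apply: (loop_apart _ _ xe).
      exact: uniq_cross es ft.
    by have [d1 d2] := cycle_edges_dom ds es; have [d3 d4] := cycle_edges_dom dt ft;
      rewrite /= d1 d2 d3 d4.
  - by move=> x /base_cycle_loop[e /(cycle_edges_dom ds)[d1 d2]]; apply: loop_avoids.
  - by have [d1 d2] := cycle_edges_dom dt ft; apply: loop_avoids.
rewrite [X in _ (+) X]exchange_big -big_split /edge_pairs big_allpairs_dep.
apply: eq_bigr => e _.
have -> : lkp (loop e) (path_cycle t) = \big[addb/false]_(f <- cycle_edges t)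
   (lkp (loop e) [:: base_seg f] (+) lkp (loop e) (loop f)).
  rewrite big_split -stepr -lk_big -base_flat /=.
  by case: (lkp _ _); case: (lkp _ _).
rewrite -big_split; apply: eq_bigr => f _; rewrite /correction /=.
by rewrite -!addbA; congr addb; rewrite addbC.
Qed.

Lemma correction_sym w : uniq [:: w.1.1; w.1.2; w.2.1; w.2.2] ->
  all dom [:: w.1.1; w.1.2; w.2.1; w.2.2] ->
  correction (sorted_pair w) = correction w.
Proof.
rewrite /sorted_pair; case: ifP => // _ uw /= /and5P[d1 d2 d3 d4 _];
  rewrite /correction /lkp /=.
rewrite (lk_sym genP pqr (closed_loop w.2) (closed_loop w.1)).
- by rewrite [X in X (+) _]addbC.
- by apply/apart_sym/loop_apart; rewrite //= d1 d2 d3 d4.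
- exact: loop_avoids.
- exact: loop_avoids.
Qed.

(** Moving all edges of the graph changes the linking number of [s] and [t] by a
    sum over the pairs of an edge of [s] and an edge of [t] of a symmetric
    quantity; along an even cover these cancel in pairs. *)
Theorem lk_even_cover (S : seq (seq nat * seq nat)) :
  all (fun st => [&& uniq (st.1 ++ st.2), 1 < size st.1, 1 < size st.2,
     all dom st.1 & all dom st.2]%N) S ->
  even_cover S ->
  \big[addb/false]_(st <- S) lkp (path_cycle st.1) (path_cycle st.2) =
  \big[addb/false]_(st <- S) lkp (base_cycle st.1) (base_cycle st.2).
Proof.
move=> /allP uS ev.
suff : \big[addb/false]_(st <- S) (lkp (path_cycle st.1) (path_cycle st.2)
    (+) lkp (base_cycle st.1) (base_cycle st.2)) = false.
  by rewrite big_split /=; case: (\big[addb/false]_(_ <- _) _);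
    case: (\big[addb/false]_(_ <- _) _).
transitivity (\big[addb/false]_(st <- S) \big[addb/false]_(w <- edge_pairs st) correction
  (sorted_pair w)).
  apply: eq_big_seq => -[s t] /uS/= /and5P[ust s1 t1 ds dt].
  rewrite lk_correction//; apply: eq_big_seq => w /allpairsP[[e f] /= [es ft ->]].
  have [d1 d2] := cycle_edges_dom ds es; have [d3 d4] := cycle_edges_dom dt ft.
  by rewrite correction_sym//= ?d1 ?d2 ?d3 ?d4//; exact: uniq_cross es ft.
rewrite -(big_map edge_pairs predT (fun l => \big[addb/false]_(w <- l) correction
  (sorted_pair w))).
rewrite -big_flatten -(big_map sorted_pair predT correction).
exact: big_addb_even.
Qed.
End Parity.

(** * Counting linked pairs of cycles *)

Section Combinatorics.
Local Open Scope nat_scope.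

Fixpoint words (k : nat) : seq (seq nat) :=
  if k is k'.+1 then [seq x :: s | x <- iota 0 7, s <- words k'] else [:: [::]].

(** The vertices 0 and 1 form the part of size two. *)
Definition joined (x y : nat) : bool := (x != y) && ((1 < x) || (1 < y)).

(** Among the lists that describe one cycle, this selects the one starting at the
    least vertex and going on with the smaller of its neighbours. *)
Definition normal_cycle (s : seq nat) : bool :=
  [&& uniq s, cycle joined s, all (leq (head 0 s)) s & nth 0 s 1 < last 0 s].

Definition cycles (k : nat) := [seq s <- words k | normal_cycle s].

Definition pairs33 := [seq st <- [seq (s, t) | s <- cycles 3, t <- cycles 3] |
  uniq (st.1 ++ st.2) && (head 0 st.1 < head 0 st.2)].

Definition pairs34 := [seq st <- [seq (s, t) | s <- cycles 3, t <- cycles 4] |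
  uniq (st.1 ++ st.2)].

(** The ten pairs of triangles of a copy of K_6. *)
Definition without v := [seq st <- pairs33 | v \notin st.1 ++ st.2].

Definition with01 := [seq st <- pairs33 | (0 \in st.1 ++ st.2) && (1 \in st.1 ++ st.2)].

Definition square01 := [seq st <- pairs34 | (0 \in st.2) && (1 \in st.2)].

Definition triangle01 := [seq st <- pairs34 | (0 \in st.1) || (1 \in st.1)].

(** The pairs of disjoint cycles of the copy of K_{3,3,1} whose cone vertex is [vx.1]
    and where 0, 1 and [vx.2] form a part. *)
Definition K331 (vx : nat * nat) : seq (seq nat * seq nat) :=
  let side y := y \in [:: 0; 1; vx.2] in
  let e y z := [|| y == vx.1, z == vx.1 | side y != side z] in
  [seq st <- pairs34 | cycle e st.1 && cycle e st.2].

(** If all the pairs in [triangle01] were unlinked, linking numbers of triangles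
    through 0 with triangles disjoint from them would all be equal, against the
    oddness of [without 1]. These fifteen pairs have the same sum as [without 1]: in
    each of its ten pairs, the triangle on the side avoiding 0 is replaced by a square
    through 1 plus a triangle through 1, and the ten triangles of the latter kind are
    made to coincide two by two, their partners then adding up to a square through 0. *)
Definition witness_list := flatten [seq let v k := 2 + (i + k) %% 5 in
   [:: ([:: 0; v 0; v 1], [:: 1; v 3; v 2; v 4]);
       ([:: 0; v 0; v 2], [:: 1; v 3; v 1; v 4]);
       ([:: 1; v 3; v 4], [:: 0; v 1; v 0; v 2])] | i <- iota 0 5].

Definition same_cycle (s t : seq nat) := perm_eq (cycle_edges s) (cycle_edges t).

Definition witness := [seq st <- triangle01 |
  has (fun uv => same_cycle uv.1 st.1 && same_cycle uv.2 st.2) witness_list].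

(** The sign of [vol] on the points of the moment curve with these labels; see
    [chiE]. The parameter decreases with the label. *)
Definition chi (a b c d : nat) : bool :=
  ~~ ((a < b) (+) (a < c) (+) (a < d) (+) (b < c) (+) (b < d) (+) (c < d)).

Definition moment_hit a b c d e : bool :=
  let s := [:: chi b c d e; ~~ chi a c d e; chi a b d e; chi a b c e; ~~ chi a b c d] in
  all id s || all negb s.

(** The vertices of the graph are labelled from 0 to 6, and 7 is the apex. *)
Definition moment_lk (st : seq nat * seq nat) : bool :=
  foldr addb false [seq moment_hit w.1.1 w.1.2 7 w.2.1 w.2.2 | w <- edge_pairs st].

Definition is_cycle_pair (st : seq nat * seq nat) : bool :=
  [&& uniq (st.1 ++ st.2), 1 < size st.1, 1 < size st.2,
    all (fun v => v < 7) st.1 & all (fun v => v < 7) st.2].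

Definition K331s := [seq K331 vx | vx <- [seq (v, x) | v <- iota 2 5, x <- iota 2 5]
  & vx.1 != vx.2].

Lemma big_addb_count (A : Type) (S : seq A) (l : pred A) :
  \big[addb/false]_(x <- S) l x = odd (count l S).
Proof. by elim: S => [|x S IH]; rewrite ?big_nil// big_cons IH /= oddD oddb. Qed.

Lemma leq_size_sumn (s : seq nat) : all odd s -> size s <= sumn s.
Proof. by elim: s => //= x s IH /andP[x1 /IH]; case: x x1 => //= *; lia. Qed.

(** Write A, B, C, D and E for the five counts. A, B and C are odd, D and E are
    even, and E is positive because of [w]. The odd counts of the twenty lists in [K]
    give 20 <= 6 D + 2 E. If D = 0 then E >= 10, if D = 2 then E >= 4, if D = 4 then
    E >= 2, and in all cases the total is at least 9. *)
Lemma nine_by_parity (A : eqType) (l : pred A) (a b c d e w S : seq A) (K : seq (seq A)) :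
  odd (count l a) -> odd (count l b) -> odd (count l c) ->
  ~~ odd (count l d) -> ~~ odd (count l e) ->
  odd (count l w) -> subseq w e ->
  all (fun k => odd (count l k)) K -> size K = 20 ->
  perm_eq (flatten K) (flatten (nseq 6 d ++ nseq 2 e)) ->
  perm_eq S (a ++ b ++ c ++ d ++ e) -> 9 <= count l S.
Proof.
move=> oa ob oc od oe ow we oK K20 /permP pK /permP pS.
have e0 : 0 < count l e by apply: leq_trans (leq_count_subseq l we); rewrite odd_gt0.
have de : 20 <= 6 * count l d + 2 * count l e.
  have -> : 6 * count l d + 2 * count l e = count l (flatten K).
    rewrite pK count_flatten map_cat sumn_cat !map_nseq !sumn_nseq.
    by rewrite mulnC [X in _ + X]mulnC.
  rewrite count_flatten -K20 -(size_map (count l)).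
  by apply: leq_size_sumn; rewrite all_map.
rewrite pS !count_cat.
move: oa ob oc od oe e0 de.
move: (count l a) (count l b) (count l c) (count l d) (count l e).
by clear; lia.
Qed.

(** The two copies of K_6 obtained by removing 0 or 1 contain an odd number of
    linked pairs of triangles, and so does the rest of the pairs of triangles; the
    copies of K_{3,3,1} count each pair in [square01] six times and each pair in
    [triangle01] twice. *)
Theorem nine_odd_pairs (l : seq nat * seq nat -> bool) :
  (forall S, all is_cycle_pair S -> even_cover S ->
    \big[addb/false]_(st <- S) l st = \big[addb/false]_(st <- S) moment_lk st) ->
  9 <= count l (pairs33 ++ pairs34).
Proof.
move=> lE; have oddE S (b : bool) : [&& all is_cycle_pair S, even_cover S &
    odd (count moment_lk S) == b] -> odd (count l S) = b.
  by case/and3P => cS eS /eqP <-; rewrite -!big_addb_count lE.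
apply: (@nine_by_parity _ l (without 0) (without 1) with01 square01 triangle01 witness _
  K331s).
- by apply: (oddE _ true); vm_compute.
- by apply: (oddE _ true); vm_compute.
- by apply: (oddE _ true); vm_compute.
- by apply/negbT/(oddE _ false); vm_compute.
- by apply/negbT/(oddE _ false); vm_compute.
- by apply: (oddE _ true); vm_compute.
- exact: filter_subseq.
- have /allP Kok : all (fun S => [&& all is_cycle_pair S, even_cover S &
      odd (count moment_lk S) == true]) K331s by vm_compute.
  by apply/allP => S /Kok/oddE.
- by vm_compute.
- by vm_compute.
- by vm_compute.
Qed.

End Combinatorics.

(** * Points in general position *)

Local Open Scope classical_set_scope.
Local Open Scope ring_scope.

Section Perturbation.
Variable R : realType.

(** Points of the moment curve, four of which are never coplanar. The parameters are
    bounded, so that all labels can be perturbed uniformly. *)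
Definition moment (k : nat) : 'rV[R]_3 := \row_i (k.+1%:R^-1) ^+ i.+1.

Lemma vol_moment a b c d (u := fun k : nat => k.+1%:R^-1 : R) :
  vol (moment a) (moment b) (moment c) (moment d) =
  (u b - u a) * (u c - u a) * (u d - u a) * (u c - u b) * (u d - u b) * (u d - u c).
Proof. by rewrite /vol /moment !mxE -/(u a) -/(u b) -/(u c) -/(u d); ring. Qed.

Lemma vol_scale (K : comNzRingType) (t : K) (a b c d : 'rV[K]_3) :
  vol (t *: a) (t *: b) (t *: c) (t *: d) = t ^+ 3 * vol a b c d.
Proof. by rewrite /vol !mxE; ring. Qed.

Lemma vol_map (K L : comNzRingType) (f : {rmorphism K -> L}) (a b c d : 'rV[K]_3) :
  f (vol a b c d) = vol (map_mx f a) (map_mx f b) (map_mx f c) (map_mx f d).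
Proof. by rewrite /vol !mxE !(rmorphB, rmorphD, rmorphM). Qed.

Lemma param_neq (a b : nat) : a != b -> (b.+1%:R^-1 - a.+1%:R^-1 : R) != 0.
Proof. by rewrite subr_eq0 (inj_eq invr_inj) eqr_nat eqSS eq_sym. Qed.

Lemma vol_moment_neq0 a b c d : uniq [:: a; b; c; d] ->
  vol (moment a) (moment b) (moment c) (moment d) != 0.
Proof.
rewrite /= !inE !negb_or !andbT => /and3P[/and3P[ab ac ad] /andP[bc bd] cd].
by rewrite vol_moment !mulf_neq0 ?param_neq.
Qed.

Lemma root_set_finite (q : {poly R}) : q != 0 -> finite_set [set s | root q s].
Proof.
move=> q0; apply: contrapT => /(infinite_set_fset (size q))[B BA].
rewrite leqNgt => /negP; apply; apply: max_poly_roots => //; last exact: finmap.fset_uniq.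
by apply/allP => s sB; apply: BA.
Qed.

Lemma uncountable_ray (m : R) (A : set R) : countable A -> exists2 s, m < s & ~ A s.
Proof.
move=> cA; apply: contrapT => nA.
have sub : `]m, +oo[%classic `<=` A.
  move=> s; rewrite /= in_itv/= andbT => ms; apply: contrapT => nAs.
  by apply: nA; exists s.
have := countable_lebesgue_measure0 (sub_countable (subset_card_le sub) cA).
by rewrite lebesgue_measure_itv /= ltry.
Qed.

(** The points [s *: x k + moment k] are in general position when [s = 0], so each
    coplanarity between four labels is a nonzero polynomial condition on [s]. There
    are countably many of them, hence arbitrarily large values of [s] satisfying
    none, and dividing by a large [s] makes the perturbation small. *)
Lemma generic_perturbation (x : nat -> 'rV[R]_3) (eta : R) : 0 < eta ->
  exists2 t, 0 < t < eta & generic (fun k => x k + t *: moment k).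
Proof.
move=> eta0.
pose pt (k : nat) : 'rV[{poly R}]_3 := \row_i ((x k ord0 i) *: 'X + (moment k ord0 i)%:P).
pose q (w : nat * nat * nat * nat) := vol (pt w.1.1.1) (pt w.1.1.2) (pt w.1.2) (pt w.2).
have qE w s : (q w).[s] = vol (s *: x w.1.1.1 + moment w.1.1.1)
  (s *: x w.1.1.2 + moment w.1.1.2) (s *: x w.1.2 + moment w.1.2) (s *: x w.2 + moment w.2).
  rewrite -[LHS]/(horner_eval s _) vol_map; congr (vol _ _ _ _);
    by apply/rowP => i; rewrite !mxE /= /horner_eval !hornerE mulrC.
pose D : set (nat * nat * nat * nat) :=
  [set w | uniq [:: w.1.1.1; w.1.1.2; w.1.2; w.2]].
have cD : countable (\bigcup_(w in D) [set s | root (q w) s]).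
  apply: bigcup_countable => // w Dw; apply/finite_set_countable/root_set_finite.
  apply/negP => /eqP q0; have := qE w 0; rewrite q0 horner0 !scale0r !add0r.
  by move/esym/eqP; apply/negP/vol_moment_neq0.
have [s es nD] := uncountable_ray (Num.max 0 eta^-1) cD.
have {es} [s0 es] : 0 < s /\ eta^-1 < s by move: es; rewrite gt_max => /andP.
exists s^-1; first by rewrite invr_gt0 s0 invf_plt ?posrE.
move=> a b c d abcd.
have E k : x k + s^-1 *: moment k = s^-1 *: (s *: x k + moment k).
  by rewrite scalerDr scalerA mulVf ?gt_eqF// scale1r.
rewrite /= !E vol_scale mulf_neq0 ?expf_neq0 ?invr_neq0 ?(gt_eqF s0)//.
apply/negP => /eqP v0; apply: nD; exists (a, b, c, d) => //=.
by rewrite /root qE /= v0.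
Qed.

Lemma chiE a b c d (t : R) : 0 < t -> uniq [:: a; b; c; d] ->
  (0 < vol (t *: moment a) (t *: moment b) (t *: moment c) (t *: moment d)) = chi a b c d.
Proof.
move=> t0; rewrite /= !inE !negb_or !andbT => /and3P[/and3P[ab ac ad] /andP[bc bd] cd].
rewrite vol_scale pmulr_rgt0 ?exprn_gt0// vol_moment.
have lt1 x y : x != y -> (0 < (y.+1%:R^-1 - x.+1%:R^-1 : R)) = ~~ (x < y)%N.
  by move=> xy; rewrite subr_gt0 ltf_pV2 ?posrE ?ltr0n// ltr_nat ltnS -leqNgt ltn_neqAle
    eq_sym xy.
have mul (u v : R) : u != 0 -> v != 0 -> (0 < u * v) = ~~ ((0 < u) (+) (0 < v)).
  move=> u0 v0; case: (ltrgtP 0 u) u0 => //= u1 _; case: (ltrgtP 0 v) v0 => //= v1 _.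
  - by rewrite mulr_gt0.
  - by apply/negbTE; rewrite -leNgt ltW// pmulr_rlt0.
  - by apply/negbTE; rewrite -leNgt ltW// nmulr_rlt0.
  - by rewrite nmulr_rgt0.
rewrite !mul ?mulf_neq0 ?param_neq// !lt1// /chi.
by do 6!case: (_ < _)%N.
Qed.

Lemma hit_moment a b c d e (t : R) : 0 < t -> uniq [:: a; b; c; d; e] ->
  hit (t *: moment a) (t *: moment b) (t *: moment c) (t *: moment d) (t *: moment e)
  = moment_hit a b c d e.
Proof.
move=> t0 u; have u4 m : uniq (mask m [:: a; b; c; d; e]) by exact: mask_uniq.
have lt0 p q r s : uniq [:: p; q; r; s] ->
  (vol (t *: moment p) (t *: moment q) (t *: moment r) (t *: moment s) < 0) = ~~ chi p q r
    s.
  move=> pqrs; rewrite -(chiE t0 pqrs) -leNgt lt_neqAle vol_scale.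
  by rewrite (mulf_neq0 _ (vol_moment_neq0 pqrs)) ?expf_neq0 ?lt0r_neq0.
have h1 := u4 [:: false; true; true; true; true].
have h2 := u4 [:: true; false; true; true; true].
have h3 := u4 [:: true; true; false; true; true].
have h4 := u4 [:: true; true; true; false; true].
have h5 := u4 [:: true; true; true; true; false].
rewrite /hit /same_sign /dependency /moment_hit /= !oppr_gt0 !oppr_lt0.
by rewrite !lt0// !chiE// !negbK !andbT.
Qed.
End Perturbation.

(** * Contracting a polygon away from another one *)

Section HitGeometry.
Variable R : realType.
Implicit Types a b c d e : 'rV[R]_3.

Lemma rowP3 a b : a ord0 o0 = b ord0 o0 -> a ord0 o1 = b ord0 o1 ->
  a ord0 o2 = b ord0 o2 -> a = b.
Proof.
move=> h0 h1 h2; apply/rowP => i.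
have [->|[->|->]] // : i = o0 \/ i = o1 \/ i = o2.
by case: i => -[|[|[|//]]] hi; [left|right; left|right; right]; apply: val_inj.
Qed.

Lemma dependency_sum a b c d e :
  vol b c d e *: a - vol a c d e *: b + vol a b d e *: c =
  vol a b c e *: d - vol a b c d *: e.
Proof. by apply: rowP3; rewrite !mxE /vol; ring. Qed.

Lemma dependency_weights a b c d e :
  vol b c d e - vol a c d e + vol a b d e = vol a b c e - vol a b c d.
Proof. by rewrite /vol; ring. Qed.

Lemma hit_convex a b c d e : hit a b c d e -> exists x y z u v : R,
  [/\ [/\ 0 <= x, 0 <= y, 0 <= z, 0 <= u & 0 <= v], x + y + z = 1, u + v = 1 &
      x *: a + y *: b + z *: c = u *: d + v *: e].
Proof.
wlog H : / [&& 0 < vol b c d e, 0 < - vol a c d e, 0 < vol a b d e,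
    0 < vol a b c e & 0 < - vol a b c d] || [&& vol b c d e < 0, - vol a c d e < 0,
    vol a b d e < 0, vol a b c e < 0 & - vol a b c d < 0].
  move=> W h; apply: W => //; move: h; rewrite /hit /same_sign /= !andbT.
  by [].
move=> _; have S := dependency_sum a b c d e; have W := dependency_weights a b c d e.
pose s := vol a b c e - vol a b c d.
have s0 : s != 0.
  by case/orP: H => /and5P[h1 h2 h3 h4 h5]; [apply: lt0r_neq0|apply: ltr0_neq0];
    rewrite /s; lra.
exists (vol b c d e / s), (- vol a c d e / s), (vol a b d e / s), (vol a b c e / s),
  (- vol a b c d / s).
split.
- case/orP: H => /and5P[h1 h2 h3 h4 h5]; split;
    by [apply: divr_ge0; rewrite /s; lra | apply: mulr_le0; rewrite ?invr_le0 /s; lra].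
- by rewrite -!mulrDl W divff.
- by rewrite -mulrDl divff.
- have := congr1 (fun w => s^-1 *: w) S; rewrite !scalerDr !scalerN !scalerA => E.
  by rewrite !mulNr !scaleNr !(mulrC _ s^-1) E.
Qed.

(** A point common to the triangle and the segment is close to [a] and to [d]. *)
Lemma hit_near a b c d e (rho : R) : hit a b c d e ->
  `|a - b| <= rho -> `|a - c| <= rho -> `|d - e| <= rho -> `|a - d| <= rho *+ 2.
Proof.
move=> /hit_convex[x [y [z [u [v [[x0 y0 z0 u0 v0] xyz uv E]]]]]] ab ac de.
have -> : a - d = y *: (a - b) + z *: (a - c) - v *: (d - e).
  have xE : x = 1 - y - z by rewrite -xyz; ring.
  have uE : u = 1 - v by rewrite -uv; ring.
  move: E; rewrite xE uE => E; apply/rowP => i.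
  by have := congr1 (fun w : 'rV_3 => w 0 i) E; rewrite !mxE; lra.
have yz : y + z <= 1 by lra.
have v1 : v <= 1 by lra.
have rho0 : 0 <= rho by apply: le_trans ab.
apply: le_trans (ler_normB _ _) _; rewrite mulr2n; apply: lerD.
  apply: le_trans (ler_normD _ _) _; rewrite !normrZ !ger0_norm//.
  by apply: (@le_trans _ _ ((y + z) * rho)); [rewrite mulrDl lerD// ler_wpM2l|rewrite
    ler_piMl].
by rewrite normrZ ger0_norm//; apply: (@le_trans _ _ (v * rho));
  [rewrite ler_wpM2l|rewrite ler_piMl].
Qed.
End HitGeometry.

Section Shrinking.
Variables (R : realType) (T U : eqType) (P : T -> 'rV[R]_3).
Hypothesis genP : generic P.
Variables (p q r : T).
Hypothesis pqr : uniq [:: p; q; r].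
Variables (C : seq (U * U)) (D : seq (T * T)) (rg : nat -> U -> T).
Hypotheses (cC : closed_chain C) (cD : closed_chain D).

(** The sample points of [C] as they arrive on the [k]-th ring of a contraction. *)
Definition ring_chain k := [seq (rg k s.1, rg k s.2) | s <- C].

Hypothesis rg_inj : forall k l u v, rg k u = rg l v -> k = l /\ u = v.
Hypothesis rg_apex : forall k u, rg k u \notin [:: p; q; r].
Hypothesis D_apex : avoids [:: p; q; r] D.
Hypothesis C_proper : forall s, s \in C -> s.1 != s.2.
Hypothesis D_rg : forall t k u, t \in D ->
  [/\ t.1 != t.2, t.1 != rg k u & t.2 != rg k u].

Definition misses i j k := forall t, t \in D -> ~~ hit (P i) (P j) (P k) (P t.1) (P t.2).

Lemma lk_misses k1 u1 k2 u2 k3 u3 (i := rg k1 u1) (j := rg k2 u2) (k := rg k3 u3) :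
  (k1, u1) != (k2, u2) -> (k1, u1) != (k3, u3) -> (k2, u2) != (k3, u3) ->
  misses i j k -> lk P p (triangle_chain i j k) D = false.
Proof.
have neq k1' u1' k2' u2' : (k1', u1') != (k2', u2') -> rg k1' u1' != rg k2' u2'.
  by apply: contra_neq => /rg_inj[-> ->].
move=> /neq ij /neq ik /neq jk m.
have uq a b ka ua kb ub t : a = rg ka ua -> b = rg kb ub -> a != b -> t \in D ->
    uniq [:: a; b; t.1; t.2].
  move=> -> -> ab tD; have [tt t1 t2] := D_rg ka ua tD; have [_ t3 t4] := D_rg kb ub tD.
  by rewrite /= !inE !negb_or !andbT ab tt (eq_sym _ t.1) (eq_sym _ t.2) t1 t2 eq_sym t3
    eq_sym t4.
have triP s : s \in triangle_chain i j k -> [\/ s = (i, j), s = (i, k) | s = (j, k)].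
  by rewrite !inE => /or3P[]/eqP->; constructor.
rewrite (lk_triangle genP pqr)//.
- by rewrite big1_seq// => t /andP[_ /m/negbTE].
- by move=> s t /triP[]-> tD /=; apply: uq tD.
- by move=> s /triP[]->; apply/andP; split; apply: rg_apex.
Qed.

Let phi x := \big[addb/false]_(t <- D) hits P p x t.

Lemma lk_triangleE i j k :
  lk P p (triangle_chain i j k) D = phi (i, j) (+) phi (i, k) (+) phi (j, k).
Proof. by rewrite /lk !big_cons big_nil addbF addbA. Qed.

Lemma lk_ring_chain k : lk P p (ring_chain k) D =
  \big[addb/false]_(s <- C) phi (rg k s.1, rg k s.2).
Proof. by rewrite /lk big_map. Qed.

(** Between two consecutive rings each segment sweeps a quadrangle, cut into two
    triangles; the sides joining the rings cancel since [C] is closed. *)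
Lemma lk_next_ring k :
  (forall s, s \in C -> misses (rg k s.1) (rg k s.2) (rg k.+1 s.2) /\
     misses (rg k s.1) (rg k.+1 s.1) (rg k.+1 s.2)) ->
  lk P p (ring_chain k) D = lk P p (ring_chain k.+1) D.
Proof.
move=> m; rewrite !lk_ring_chain.
suff: \big[addb/false]_(s <- C) (phi (rg k s.1, rg k s.2) (+)
    (phi (rg k.+1 s.1, rg k.+1 s.2) (+)
    (phi (rg k s.1, rg k.+1 s.1) (+) phi (rg k s.2, rg k.+1 s.2)))) = false.
  rewrite !big_split /= -[X in _ (+) (_ (+) X)]big_split /=.
  rewrite (cC (fun u => phi (rg k u, rg k.+1 u))) addbF.
  by case: (\big[_/_]_(_ <- _) _); case: (\big[_/_]_(_ <- _) _).
rewrite big1_seq// => s /andP[_ sC]; have [m1 m2] := m s sC; have s12 := C_proper sC.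
have := lk_triangleE (rg k s.1) (rg k s.2) (rg k.+1 s.2).
rewrite lk_misses //; [|by rewrite xpair_eqE eqxx|by rewrite xpair_eqE ltn_eqF|by rewrite
  xpair_eqE ltn_eqF].
have := lk_triangleE (rg k s.1) (rg k.+1 s.1) (rg k.+1 s.2).
rewrite lk_misses //; [|by rewrite xpair_eqE ltn_eqF|by rewrite xpair_eqE ltn_eqF|by
  rewrite xpair_eqE eqxx].
by do 5!case: (phi _).
Qed.

(** The last ring is filled by a cone. *)
Lemma lk_cone k z :
  (forall s, s \in C -> misses (rg k.+1 z) (rg k s.1) (rg k s.2)) ->
  lk P p (ring_chain k) D = false.
Proof.
move=> m; rewrite lk_ring_chain.
have := cC (fun u => phi (rg k.+1 z, rg k u)).
suff: \big[addb/false]_(s <- C) (phi (rg k s.1, rg k s.2) (+)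
    (phi (rg k.+1 z, rg k s.1) (+) phi (rg k.+1 z, rg k s.2))) = false.
  by rewrite big_split /= => + E; rewrite E addbF.
rewrite big1_seq// => s /andP[_ sC]; have s12 := C_proper sC.
have := lk_triangleE (rg k.+1 z) (rg k s.1) (rg k s.2).
rewrite lk_misses; [|by rewrite xpair_eqE gtn_eqF|by rewrite xpair_eqE gtn_eqF|by rewrite
  xpair_eqE eqxx|exact: m].
by do 3!case: (phi _).
Qed.

(** The linking number with [D] is the same on all rings, and zero on the last one. *)
Lemma lk_contracted m z :
  (forall k s, (k < m)%N -> s \in C -> misses (rg k s.1) (rg k s.2) (rg k.+1 s.2) /\
     misses (rg k s.1) (rg k.+1 s.1) (rg k.+1 s.2)) ->
  (forall s, s \in C -> misses (rg m.+1 z) (rg m s.1) (rg m s.2)) ->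
  lk P p (ring_chain 0) D = false.
Proof.
move=> mk mm; suff E k : (k <= m)%N -> lk P p (ring_chain 0) D = lk P p (ring_chain k) D.
  by rewrite (E m)// (lk_cone mm).
elim: k => // k IH km; rewrite IH 1?ltnW//; apply: lk_next_ring => s; exact: mk.
Qed.

End Shrinking.

(** * The two sides of a tame sphere *)

Section Compactness.
Variable R : realType.

Lemma compact_uniform_continuous (V W : normedModType R) (A : set V) (f : V -> W) (e : R) :
  compact A -> {within A, continuous f} -> 0 < e ->
  exists2 d, 0 < d & forall x y, A x -> A y -> `|x - y| < d -> `|f x - f y| < e.
Proof.
move=> /compact_near_coveringP cA /subspace_continuousP cf e0.
have := cA R 0^'+ (fun d x => forall y, A x -> A y -> `|x - y| < d -> `|f x - f y| < e) _.
case.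
- move=> x Ax; have /cvgrPdist_lt/(_ (e / 2)) := cf x Ax.
  rewrite divr_gt0// => /(_ isT); rewrite /within/= => /nbhs_ballP[d /= d0 Bd].
  have d2 : 0 < d / 2 by rewrite divr_gt0.
  exists (ball x (d / 2), [set r | r < d / 2]) => /=.
    split; first exact: nbhsx_ballx.
    exact: nbhs_right_lt.
  move=> [x' d'] /= [Bx' d'd] y Ax' Ay xy.
  rewrite -ball_normE /= in Bx'.
  have fx' : `|f x - f x'| < e / 2.
    by apply: Bd => //; rewrite -ball_normE /=; lra.
  have fy : `|f x - f y| < e / 2.
    apply: Bd => //; rewrite -ball_normE /=.
    by have := ler_distD x' x y; lra.
  by have := ler_distD (f x) (f x') (f y); rewrite (distrC (f x') (f x)); lra.
- move=> d /= d0 H; exists (d / 2); first by rewrite divr_gt0.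
  move=> x y Ax Ay xy; apply: (H (d / 2) _ _ x Ax y) => //=.
  + by rewrite sub0r normrN gtr0_norm ?divr_gt0//; lra.
  + by rewrite divr_gt0.
Qed.

Lemma compact_closed_dist (V : normedModType R) (A B : set V) :
  compact A -> closed B -> A `&` B = set0 ->
  exists2 d, 0 < d & forall x y, A x -> B y -> d <= `|x - y|.
Proof.
move=> /compact_near_coveringP cA cB AB0.
have := cA R 0^'+ (fun d x => forall y, B y -> d <= `|x - y|) _.
case.
- move=> x Ax; have nBx : (~` B) x by move=> Bx; have : (A `&` B) x by []; rewrite AB0.
  have /nbhs_ballP[d /= d0 Bd] : nbhs x (~` B).
    by apply: open_nbhs_nbhs; split => //; rewrite openC.
  have d2 : 0 < d / 2 by rewrite divr_gt0.
  exists (ball x (d / 2), [set r | r < d / 2]) => /=.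
    split; first exact: nbhsx_ballx.
    exact: nbhs_right_lt.
  move=> [x' d'] /= [Bx' d'd] y By; rewrite -ball_normE /= in Bx'.
  rewrite leNgt; apply/negP => xy; apply: (Bd y) => //.
  by rewrite -ball_normE /=; have := ler_distD x' x y; lra.
- move=> d /= d0 H; exists (d / 2); first by rewrite divr_gt0.
  move=> x y Ax By; apply: (H (d / 2) _ _ x Ax y) => //=.
  + by rewrite sub0r normrN gtr0_norm ?divr_gt0//; lra.
  + by rewrite divr_gt0.
Qed.
End Compactness.

Section Sphere.
Variable R : realType.
Implicit Types x y z a : 'rV[R]_3.

Lemma sum3 (V : nmodType) (F : 'I_3 -> V) : \sum_i F i = F o0 + F o1 + F o2.
Proof.
rewrite !big_ord_recl big_ord0 addr0 !addrA.
by do ![congr (_ + _) | congr F; apply: val_inj].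
Qed.

Definition dot x y := x ord0 o0 * y ord0 o0 + x ord0 o1 * y ord0 o1 + x ord0 o2 * y ord0 o2.

Lemma unit_sphereE x : unit_sphere x = (dot x x = 1).
Proof. by rewrite /unit_sphere /= sum3 !expr2. Qed.

Lemma dot_continuous : continuous (fun x => dot x x).
Proof.
move=> x; have c i := @coord_continuous R 1 3 ord0 i x.
have cM i : {for x, continuous (fun y : 'rV[R]_3 => y ord0 i * y ord0 i)}.
  by apply: continuousM; exact: c.
exact: (continuousD (continuousD (cM o0) (cM o1)) (cM o2)).
Qed.

Lemma dotC x y : dot x y = dot y x.
Proof. by rewrite /dot; ring. Qed.

Lemma dotDr x y z : dot x (y + z) = dot x y + dot x z.
Proof. by rewrite /dot !mxE; ring. Qed.

Lemma ord3P (i : 'I_3) : [\/ i = o0, i = o1 | i = o2].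
Proof.
by case: i => -[|[|[|//]]] hi; [constructor 1|constructor 2|constructor 3]; apply: val_inj.
Qed.

Lemma dot_delta x i (k : R) : dot x (k *: delta_mx ord0 i) = k * x ord0 i.
Proof. by rewrite /dot !mxE /=; case: (ord3P i) => -> /=; ring. Qed.

Lemma dot_ge0 x : 0 <= dot x x.
Proof. by rewrite /dot; nra. Qed.

Lemma dot_comb x y (t : R) : dot ((1 - t) *: x + t *: y) ((1 - t) *: x + t *: y) =
  (1 - t) * dot x x + t * dot y y - t * (1 - t) * dot (x - y) (x - y).
Proof. by rewrite /dot !mxE; ring. Qed.

Lemma dot_combr a x y (t : R) : dot a ((1 - t) *: x + t *: y) =
  (1 - t) * dot a x + t * dot a y.
Proof. by rewrite /dot !mxE; ring. Qed.

Lemma dot_cauchy x y : dot x y ^+ 2 <= dot x x * dot y y.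
Proof.
rewrite -subr_ge0.
have -> : dot x x * dot y y - dot x y ^+ 2 =
  (x ord0 o0 * y ord0 o1 - x ord0 o1 * y ord0 o0) ^+ 2 +
  (x ord0 o0 * y ord0 o2 - x ord0 o2 * y ord0 o0) ^+ 2 +
  (x ord0 o1 * y ord0 o2 - x ord0 o2 * y ord0 o1) ^+ 2 by rewrite /dot; ring.
by rewrite !addr_ge0 ?sqr_ge0.
Qed.

Lemma segment_component (V : topologicalType) (h : 'rV[R]_3 -> V) (S : set V) x y :
  continuous h -> (forall t, 0 <= t <= 1 -> ~ S (h ((1 - t) *: x + t *: y))) ->
  connected_component (~` S) (h x) (h y).
Proof.
move=> ch nS; pose w (t : R) := h ((1 - t) *: x + t *: y).
exists (w @` `[0, 1]); last first.
  by exists 1; [rewrite /= in_itv/= ler01 lexx|rewrite /w subrr scale0r add0r scale1r].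
split.
- by exists 0; [rewrite /= in_itv/= ler01 lexx|rewrite /w subr0 scale0r addr0 scale1r].
- by move=> _ [t + <-]; rewrite /= in_itv/=; exact: nS.
- apply: connected_continuous_connected; first exact: segment_connected.
  apply: continuous_subspaceT => t; apply: continuous_comp; last exact: ch.
  have c1 : (1 - u) @[u --> t] --> 1 - t by apply: cvgB; [exact: cvg_cst|exact: cvg_id].
  exact: (cvgD (cvgZr_tmp c1) (cvgZr_tmp cvg_id)).
Qed.

Section Sides.
Variables (h g : 'rV[R]_3 -> 'rV[R]_3).
Hypotheses (ch : continuous h) (hK : cancel h g).
Let S := h @` @unit_sphere R.

Lemma image_unit_sphere x : S (h x) -> dot x x = 1.
Proof. by case=> y; rewrite unit_sphereE => y1 /(can_inj hK) <-. Qed.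

Lemma inside_component x y : dot x x < 1 -> dot y y < 1 ->
  connected_component (~` S) (h x) (h y).
Proof.
move=> x1 y1; apply: segment_component => // t /andP[t0 t1] /image_unit_sphere.
rewrite dot_comb => E; have := dot_ge0 (x - y).
have : (1 - t) * dot x x + t * dot y y < 1.
  have [->|t0'] := eqVneq t 0; first by lra.
  have tp : 0 < t by rewrite lt_neqAle eq_sym t0'.
  have : t * dot y y < t by rewrite gtr_pMr.
  have : (1 - t) * dot x x <= 1 - t by rewrite ler_piMr; lra.
  by lra.
have : 0 <= t * (1 - t) by rewrite mulr_ge0//; lra.
by move=> tt lt d0; have := mulr_ge0 tt d0; lra.
Qed.

(** A half-space that misses the unit sphere is connected, hence lies on one side
    of it. *)
Lemma half_space_component a x y (c : R) : 0 < c -> dot a a < c ^+ 2 ->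
  c <= dot a x -> c <= dot a y -> connected_component (~` S) (h x) (h y).
Proof.
move=> c0 ac ax ay; apply: segment_component => // t /andP[t0 t1] /image_unit_sphere E.
set z := (1 - t) *: x + t *: y in E.
have az : c <= dot a z.
  rewrite dot_combr; have : (1 - t) * c <= (1 - t) * dot a x by rewrite ler_wpM2l//; lra.
  have : t * c <= t * dot a y by rewrite ler_wpM2l.
  by lra.
have := dot_cauchy a z; rewrite E mulr1 => az2.
have : c ^+ 2 <= dot a z ^+ 2 by rewrite ler_sqr ?nnegrE//; lra.
by lra.
Qed.

Lemma outside_component_axis x : 1 < dot x x ->
  exists (i : 'I_3) (s : R), s ^+ 2 = 1 /\
    connected_component (~` S) (h x) (h ((2 * s) *: delta_mx ord0 i)).
Proof.
move=> x1.
have [i xi] : exists i, x ord0 i != 0.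
  apply: contrapT => nx; have x0 i : x ord0 i = 0.
    by apply: contrapT => /eqP xi; apply: nx; exists i.
  by move: x1; rewrite /dot !x0; lra.
pose s := Num.sg (x ord0 i); exists i, s.
have s2 : s ^+ 2 = 1 by rewrite sqr_sg xi.
split=> //.
apply: (@connected_component_trans _ _ (h (x + (2 * s) *: delta_mx ord0 i))).
  apply: (@half_space_component x _ _ (dot x x)) => //; first by lra.
    by rewrite expr2 ltr_pMr; lra.
  by rewrite dotDr dot_delta -mulrA /s -normrEsg lerDl mulr_ge0.
have se y : dot (s *: delta_mx ord0 i) y = s * y ord0 i by rewrite dotC dot_delta.
apply: (@half_space_component (s *: delta_mx ord0 i) _ _ 2) => //.
- by rewrite se !mxE !eqxx mulr1 -expr2 s2 expr2; lra.
- rewrite se !mxE !eqxx mulr1 mulrDr /s -normrEsg -/s.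
  by have := normr_ge0 (x ord0 i); have : s * (2 * s) = 2 * s ^+ 2 by [ring];
    rewrite s2 => ->; lra.
- by rewrite se !mxE !eqxx mulr1; have -> : s * (2 * s) = 2 * s ^+ 2 by [ring];
  rewrite s2 mulr1.
Qed.

Lemma axes_component (i j : 'I_3) (s u : R) : s ^+ 2 = 1 -> u ^+ 2 = 1 ->
  connected_component (~` S) (h ((2 * s) *: delta_mx ord0 i)) (h ((2 * u) *: delta_mx ord0
    j)).
Proof.
have diff (k l : 'I_3) (v w : R) : k != l -> v ^+ 2 = 1 -> w ^+ 2 = 1 ->
  connected_component (~` S) (h ((2 * v) *: delta_mx ord0 k)) (h ((2 * w) *: delta_mx ord0
    l)).
  move=> kl v2 w2; pose a : 'rV[R]_3 := v *: delta_mx ord0 k + w *: delta_mx ord0 l.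
  have ak : a ord0 k = v by rewrite !mxE !eqxx (negbTE kl) mulr1 mulr0 addr0.
  have al : a ord0 l = w by rewrite !mxE !eqxx eq_sym (negbTE kl) mulr1 mulr0 add0r.
  have vv (b : R) : b ^+ 2 = 1 -> 2 * b * b = 2 by rewrite -mulrA -expr2 => ->;
    rewrite mulr1.
  apply: (@half_space_component a _ _ 2) => //.
  - by rewrite {2}/a dotDr !dot_delta ak al -!expr2 v2 w2; lra.
  - by rewrite dot_delta ak vv.
  - by rewrite dot_delta al vv.
move=> s2 u2; have [->|ij] := eqVneq i j; last exact: diff.
have [k kj] : exists k, k != j.
  by exists (if j == o0 then o1 else o0); case: (eqVneq j o0) => [->|] //; rewrite eq_sym.
have o2 : (1 : R) ^+ 2 = 1 by rewrite expr1n.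
apply: connected_component_trans (diff k j 1 u kj o2 u2).
by apply: diff; rewrite // eq_sym.
Qed.

(** Half-spaces lead from any point outside the sphere to a point on an axis, and from
    an axis to another. *)
Lemma outside_component x y : 1 < dot x x -> 1 < dot y y ->
  connected_component (~` S) (h x) (h y).
Proof.
move=> /outside_component_axis[i [s [s2 xi]]] /outside_component_axis[j [u [u2 yj]]].
apply: connected_component_trans xi _; apply: connected_component_sym.
apply: connected_component_trans yj _; exact: axes_component.
Qed.

End Sides.

(** Both sides of the sphere are connected, so that two curves which it separates
    cannot have points on the same side. *)
Lemma split_inside_outside (L M : set 'rV[R]_3) : L !=set0 -> M !=set0 ->
  split_link L M -> exists h g, [/\ continuous h, continuous g, cancel h g, cancel g h &
   (forall x, L x -> dot (g x) (g x) < 1) /\ (forall x, M x -> 1 < dot (g x) (g x)) \/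
   (forall x, M x -> dot (g x) (g x) < 1) /\ (forall x, L x -> 1 < dot (g x) (g x))].
Proof.
move=> [l0 Ll0] [m0 Mm0] [S [[h [ch [g [cg hK gK]]] ->] LS MS sep]].
exists h, g; split=> //.
have off x : (~` (h @` @unit_sphere R)) x -> dot (g x) (g x) < 1 \/ 1 < dot (g x) (g x).
  move=> nS; case: (ltrgtP (dot (g x) (g x)) 1) => [lt|gt|eq1]; [by left|by right|].
  by case: nS; exists (g x); rewrite ?unit_sphereE ?gK.
have sepI x y : L x -> M y -> dot (g x) (g x) < 1 -> dot (g y) (g y) < 1 -> False.
  by move=> Lx My x1 y1; apply: (sep x y Lx My); have := inside_component ch hK x1 y1;
    rewrite !gK.
have sepO x y : L x -> M y -> 1 < dot (g x) (g x) -> 1 < dot (g y) (g y) -> False.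
  by move=> Lx My x1 y1; apply: (sep x y Lx My); have := outside_component ch hK x1 y1;
    rewrite !gK.
case: (off _ (LS _ Ll0)) => l1; [left|right].
- have Mo y : M y -> 1 < dot (g y) (g y).
    by move=> My; case: (off _ (MS _ My)) => // /(sepI _ _ Ll0 My l1).
  by split=> // x Lx; case: (off _ (LS _ Lx)) => // x1; case: (sepO _ _ Lx Mm0 x1 (Mo _
    Mm0)).
- have Mi y : M y -> dot (g y) (g y) < 1.
    by move=> My; case: (off _ (MS _ My)) => // /(sepO _ _ Ll0 My l1).
  by split=> // x Lx; case: (off _ (LS _ Lx)) => // x1; case: (sepI _ _ Lx Mm0 x1 (Mi _
    Mm0)).
Qed.
End Sphere.

(** * Contracted curves do not link *)

Section Contraction.
Variable R : realType.
Implicit Types x y z : 'rV[R]_3.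

Lemma mx_norm_le (n : nat) (x : 'rV[R]_n) (c : R) : 0 <= c ->
  (forall i, `|x ord0 i| <= c) -> `|x| <= c.
Proof.
move=> c0 xc; rewrite /Num.norm /= mx_normrE; apply: bigmax_le => // -[i j] _ /=.
by rewrite ord1.
Qed.

Lemma coord_le_norm (n : nat) (x : 'rV[R]_n) i : `|x ord0 i| <= `|x|.
Proof.
by rewrite [leRHS]/Num.norm /= mx_normrE; apply/bigmax_geP; right => /=; exists (ord0, i).
Qed.

Lemma dot_norm x : dot x x <= 1 -> `|x| <= 1.
Proof.
move=> x1; apply: mx_norm_le => // i.
have : x ord0 i ^+ 2 <= 1.
  by apply: le_trans x1; rewrite /dot; case: (ord3P i) => ->; nra.
by rewrite -(real_normK (num_real (x ord0 i))) expr_le1.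
Qed.

Definition unit_ball : set 'rV[R]_3 := [set x | dot x x <= 1].

Lemma unit_ball_compact : compact unit_ball.
Proof.
apply: bounded_closed_compact.
  by exists 1; split => // M M1 x /dot_norm x1; apply: le_trans x1 (ltW M1).
rewrite (_ : unit_ball = (fun x => dot x x) @^-1` [set r | r <= 1])//.
by apply: closed_comp; [move=> x _; exact: dot_continuous|exact: closed_le].
Qed.

Lemma unit_ball_scale x (t : R) : 0 <= t <= 1 -> dot x x <= 1 -> dot (t *: x) (t *: x) <= 1.
Proof.
move=> /andP[t0 t1] x1; have -> : dot (t *: x) (t *: x) = t ^+ 2 * dot x x.
  by rewrite /dot !mxE; ring.
by rewrite mulr_ile1 ?exprn_ge0 ?dot_ge0 ?exprn_ile1.
Qed.

(** The curve [L] contracts away from [M] through the maps [X k], and polygons that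
    follow it, and [M], with precision [d] are unlinked. The labels of the points of
    the contraction are part of the data, since they must be in general position
    with all the others. *)
Definition unlinked_at_scale (L M : set 'rV[R]_3) (d : R) (X : nat -> 'rV[R]_3 ->
  'rV[R]_3) :=
  forall (T U : eqType) (P : T -> 'rV[R]_3) (p q r : T) (C : seq (U * U)) (D : seq (T * T))
    (rg : nat -> U -> T) (a : U -> 'rV[R]_3),
  generic P -> uniq [:: p; q; r] -> closed_chain C -> closed_chain D ->
  (forall k l u v, rg k u = rg l v -> k = l /\ u = v) ->
  (forall k u, rg k u \notin [:: p; q; r]) -> avoids [:: p; q; r] D ->
  (forall s, s \in C -> s.1 != s.2) ->
  (forall t k u, t \in D -> [/\ t.1 != t.2, t.1 != rg k u & t.2 != rg k u]) ->
  (forall s, s \in C -> [/\ L (a s.1), L (a s.2) & `|a s.1 - a s.2| < d]) ->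
  (forall s k, s \in C -> `|P (rg k s.1) - X k (a s.1)| < d /\
     `|P (rg k s.2) - X k (a s.2)| < d) ->
  (forall t, t \in D -> `|P t.1 - P t.2| < d /\ exists2 z, M z & `|P t.1 - z| < d) ->
  lk P p (ring_chain C rg 0) D = false.

(** In the coordinates given by [g] the curve [L] is inside the unit ball and shrinks
    linearly to the origin; its trace is a compact set disjoint from [M], so small
    triangles along it miss [M]. Uniform continuity gives the number of steps and
    the precision. *)
Lemma contracted_unlinked (h g : 'rV[R]_3 -> 'rV[R]_3) (L M : set 'rV[R]_3) :
  continuous h -> continuous g -> cancel h g -> cancel g h -> compact L -> closed M ->
  (forall x, L x -> dot (g x) (g x) < 1) -> (forall x, M x -> 1 < dot (g x) (g x)) ->
  exists d X, [/\ 0 < d, forall z, X 0 z = z & unlinked_at_scale L M d X].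
Proof.
move=> ch cg hK gK cL cM gL gM.
have cK : compact (h @` unit_ball).
  by apply: continuous_compact; [exact: continuous_subspaceT|exact: unit_ball_compact].
have KM0 : h @` unit_ball `&` M = set0.
  by rewrite -subset0 => _ [[y yB <-] /gM]; rewrite hK ltNge yB.
have [d0 d0_gt0 dist] := compact_closed_dist cK cM KM0.
(* A triangle of the contraction and a segment of [D] have sides at most [3 * e];
   if they met, [M] would come within [8 * e] of the trace of the contraction. *)
pose e := d0 / 20; have e0 : 0 < e by rewrite divr_gt0.
have [al al0 uh] := compact_uniform_continuous unit_ball_compact
  (continuous_subspaceT ch) e0.
have al2 : 0 < al / 2 by rewrite divr_gt0.
have [d1 d1_gt0 ug] := compact_uniform_continuous cL (continuous_subspaceT cg) al2.
pose m := Num.bound (2 / al).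
have ltm : 2 / al < m%:R by apply: archi_boundP; rewrite divr_ge0// ltW.
have m0 : (0 < m%:R :> R) by apply: le_lt_trans ltm; rewrite divr_ge0// ltW.
have mal : m%:R^-1 < al / 2 by rewrite invf_plt ?posrE// invfM invrK mulrC.
pose tau k : R := (m - k)%N%:R / m%:R.
have tau01 k : 0 <= tau k <= 1.
  by rewrite divr_ge0//= ler_pdivrMr// mul1r ler_nat leq_subr.
have tauS k : `|tau k - tau k.+1| <= m%:R^-1.
  rewrite -mulrBl normrM [X in _ * X]ger0_norm ?invr_ge0// ler_piMl ?invr_ge0//.
  case: (ltnP k m) => km; first by rewrite -natrB ?leq_sub2l// normr_nat -[leRHS]/(1%:R)
    ler_nat; lia.
  by rewrite (eqP km) (eqP (leqW km)) subrr normr0.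
pose X k z := h (tau k *: g z).
have gB z : L z -> dot (g z) (g z) <= 1 by move/gL/ltW.
have XK k z : L z -> (h @` unit_ball) (X k z).
  by move=> Lz; exists (tau k *: g z) => //; apply: unit_ball_scale; rewrite ?gB.
have Xnear k l z z' : L z -> L z' -> `|z - z'| < d1 -> `|tau k - tau l| <= m%:R^-1 ->
    `|X k z - X l z'| < e.
  move=> Lz Lz' zz' kl; apply: uh; [by apply: unit_ball_scale; rewrite ?gB..|].
  have -> : tau k *: g z - tau l *: g z' = (tau k - tau l) *: g z + tau l *: (g z - g z').
    by rewrite scalerBl scalerBr addrA subrK.
  have /andP[tl0 tl1] := tau01 l.
  have n1 : `|(tau k - tau l) *: g z| <= `|tau k - tau l|.
    by rewrite normrZ ler_piMr ?dot_norm ?gB.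
  have n2 : `|tau l *: (g z - g z')| <= `|g z - g z'|.
    by rewrite normrZ ger0_norm// ler_piMl.
  have := ler_normD ((tau k - tau l) *: g z) (tau l *: (g z - g z')).
  by have := ug _ _ Lz Lz' zz'; lra.
exists (Num.min e d1), X; split.
- by rewrite lt_min e0.
- by move=> z; rewrite /X /tau subn0 divff ?lt0r_neq0// scale1r gK.
move=> T U P p q r C D rg a gP pqr cC cD rgI rgA DA C12 Drg aL PX PD.
have Ld s u : s \in C -> u = s.1 \/ u = s.2 -> L (a u).
  by move=> sC [->|->]; have [] := aL s sC.
have PXe s k u : s \in C -> u = s.1 \/ u = s.2 -> `|P (rg k u) - X k (a u)| < e.
  by move=> sC [->|->]; have [] := PX s k sC; rewrite !lt_min => /andP[? _] /andP[].
have miss s u k1 j k : s \in C -> u = s.1 \/ u = s.2 ->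
    `|P (rg k1 u) - P j| <= 3 * e -> `|P (rg k1 u) - P k| <= 3 * e ->
    misses P D (rg k1 u) j k.
  move=> sC su ij ik t tD; apply/negP => /hit_near.
  have [] := PD t tD; rewrite !lt_min => /andP[tt _] [z Mz]; rewrite lt_min => /andP[tz _].
  have t3 : `|P t.1 - P t.2| <= 3 * e by lra.
  move=> /(_ (3 * e) ij ik t3) near; have Xk := PXe s k1 u sC su.
  have := dist _ _ (XK k1 _ (Ld s u sC su)) Mz.
  have := ler_distD (P (rg k1 u)) (X k1 (a u)) z.
  have := ler_distD (P t.1) (P (rg k1 u)) z.
  rewrite (distrC (X k1 (a u)) (P _)) mulr2n in near *.
  have : d0 = 20 * e by rewrite /e; field.
  by lra.
have close s k l u v : s \in C -> u = s.1 \/ u = s.2 -> v = s.1 \/ v = s.2 ->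
    `|tau k - tau l| <= m%:R^-1 -> `|P (rg k u) - P (rg l v)| <= 3 * e.
  move=> sC su sv kl; have := PXe s k u sC su; have := PXe s l v sC sv.
  have uv : `|a u - a v| < d1.
    have [_ _] := aL s sC; rewrite lt_min => /andP[_ s12].
    by case: su sv => -> [] ->; rewrite ?subrr ?normr0// distrC.
  have := Xnear k l _ _ (Ld s u sC su) (Ld s v sC sv) uv kl.
  have := ler_distD (X k (a u)) (P (rg k u)) (P (rg l v)).
  have := ler_distD (X l (a v)) (X k (a u)) (P (rg l v)).
  by rewrite (distrC (X l (a v)) (P _)); lra.
have tau0 k : `|tau k - tau k| <= m%:R^-1 by rewrite subrr normr0 invr_ge0 ltW.
case EC : C => [|s0 C']; first by rewrite /lk big_nil.
rewrite -EC; have s0C : s0 \in C by rewrite EC mem_head.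
apply: (@lk_contracted _ _ _ _ gP _ _ _ pqr _ _ _ cC cD rgI rgA DA C12 Drg m s0.1).
- move=> k s _ sC; have [l r'] : (s.1 = s.1 \/ s.1 = s.2) /\ (s.2 = s.1 \/ s.2 = s.2).
    by split; [left|right].
  split; apply: (miss s s.1) => //.
  + exact: (close s k k).
  + exact: (close s k k.+1).
  + exact: (close s k k.+1).
  + exact: (close s k k.+1).
have tm k : (m <= k)%N -> tau k = 0 by move=> mk; rewrite /tau (eqP mk) mul0r.
move=> s sC; have far u : u = s.1 \/ u = s.2 -> `|P (rg m.+1 s0.1) - P (rg m u)| <= 3 * e.
  move=> su; have := PXe s m u sC su; have := PXe s0 m.+1 s0.1 s0C (or_introl erefl).
  rewrite /X !tm// !scale0r => h1 h2.
  by have := ler_distD (h 0) (P (rg m.+1 s0.1)) (P (rg m u)); rewrite (distrC (h 0)); lra.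
by apply: (miss s0) => //; [left|apply: far; left|apply: far; right].
Qed.
End Contraction.

(** * Cycles of the graph *)

Definition K211111 : rel 'I_7 := complete_multipartite [:: 2; 1; 1; 1; 1; 1]%N.

Lemma K211111E (i j : 'I_7) : K211111 i j = joined i j.
Proof.
by case: i => -[|[|[|[|[|[|[|//]]]]]]] hi; case: j => -[|[|[|[|[|[|[|//]]]]]]] hj.
Qed.

Definition vertices (s : seq nat) : seq 'I_7 := [seq inord x | x <- s].

Definition below7 (s : seq nat) := all (fun x => (x < 7)%N) s.

Definition cycle_of (s : seq nat) : {set {set 'I_7}} := edges_of_seq (vertices s).

Definition edge_of (e : edge) : {set 'I_7} := ([set inord e.1; inord e.2])%SET.

Lemma verticesK s : below7 s -> map val (vertices s) = s.
Proof.
move=> /allP s7; rewrite -map_comp -[RHS]map_id; apply/eq_in_map => x /s7 x7.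
by rewrite /= inordK.
Qed.

Lemma map_valK (s : seq 'I_7) : vertices (map val s) = s.
Proof. by rewrite /vertices -map_comp -[RHS]map_id; apply: eq_map => x /=;
  rewrite inord_val. Qed.

Lemma below7_map (s : seq 'I_7) : below7 (map val s).
Proof. by apply/allP => x0 /mapP[x _ ->]; exact: ltn_ord. Qed.

Lemma edge_of_ordered (x y : 'I_7) : edge_of (ordered_edge x y) = [set x; y]%SET.
Proof. by rewrite /edge_of /ordered_edge; case: ifP => _ /=; rewrite !inord_val//
  finset.setUC. Qed.

Lemma mem_cycle_of s (S : {set 'I_7}) : below7 s -> uniq s ->
  reflect (exists2 e, e \in cycle_edges s & S = edge_of e) (S \in cycle_of s).
Proof.
move=> s7 us; have sE := verticesK s7; set u := vertices s in sE.
have E x : x \in u -> edge_of (ordered_edge (val x) (next (map val u) (val x))) = [set x;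
  next u x]%SET.
  by move=> xu; rewrite (next_map val_inj) ?edge_of_ordered// -(map_inj_uniq val_inj) sE.
rewrite /cycle_of -/u; apply: (iffP imsetP) => [[x xu ->]|[e]].
  exists (ordered_edge (val x) (next (map val u) (val x))); last by rewrite E.
  by rewrite -sE; apply: map_f; rewrite map_f.
rewrite -sE => /mapP[_ /mapP[x xu ->] ->] ->; exists x => //; exact: E.
Qed.

Lemma edge_of_inj e f : (e.1 <= e.2 < 7)%N -> (f.1 <= f.2 < 7)%N ->
  edge_of e = edge_of f -> e = f.
Proof.
case: e f => [a b] [c d] /= /andP[ab b7] /andP[cd d7] E.
have a7 := leq_ltn_trans ab b7; have c7 := leq_ltn_trans cd d7.
have inj x y : (x < 7)%N -> (y < 7)%N -> (inord x == inord y :> 'I_7) = (x == y).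
  by move=> x7 y7; apply/eqP/eqP => [/(congr1 val)/=|->//]; rewrite !inordK.
have m x : (x < 7)%N -> (x == a) || (x == b) = (x == c) || (x == d).
  move=> x7; have := congr1 (fun S : {set 'I_7} => inord x \in S) E.
  by rewrite /edge_of /= !inE !inj.
have := m a a7; have := m b b7; have := m c c7; have := m d d7.
rewrite !eqxx ?orbT /= => h1 h2 /esym h3 /esym h4.
by congr pair; lia.
Qed.

Lemma cycle_edges_ordered s e : below7 s -> e \in cycle_edges s -> (e.1 <= e.2 < 7)%N.
Proof.
move=> s7 es; have [_ e27] := cycle_edges_dom s7 es; rewrite e27 andbT.
by case/mapP: es => x _ ->; rewrite /ordered_edge; case: (leqP x (next s x)) => //= /ltnW.
Qed.

Lemma cycle_of_inj s t : below7 s -> below7 t -> uniq s -> uniq t ->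
  cycle_of s = cycle_of t ->
  all (fun e => e \in cycle_edges t) (cycle_edges s).
Proof.
move=> s7 t7 us ut E; apply/allP => e es.
have : edge_of e \in cycle_of t by rewrite -E; apply/mem_cycle_of => //; exists e.
case/(mem_cycle_of _ t7 ut) => f ft /edge_of_inj -> //; exact: cycle_edges_ordered ft ||
  exact: cycle_edges_ordered es.
Qed.

Lemma cycle_of_eq s t : below7 s -> below7 t -> uniq s -> uniq t ->
  cycle_edges s =i cycle_edges t ->
  cycle_of s = cycle_of t.
Proof.
move=> s7 t7 us ut E; apply/setP => S.
by apply/(mem_cycle_of _ s7 us)/(mem_cycle_of _ t7 ut) => -[e es ->]; exists e;
  rewrite ?E// -E.
Qed.

Lemma is_cycle_of s : below7 s -> uniq s -> cycle joined s -> (2 < size s)%N ->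
  is_cycle K211111 (cycle_of s).
Proof.
move=> s7 us cs s2; exists (vertices s); rewrite size_map; split=> //.
apply/andP; split; last by rewrite -(map_inj_uniq val_inj) verticesK.
rewrite (eq_cycle (e' := relpre val joined)); last by move=> x y; rewrite K211111E.
by rewrite -cycle_map verticesK.
Qed.

Lemma cover_cycle_of s : finset.cover (cycle_of s) = [set x in vertices s]%SET.
Proof.
apply/setP => x; rewrite !inE; apply/bigcupP/idP => [[S /imsetP[y ys ->]]|xs].
  by rewrite !inE => /orP[]/eqP-> //; rewrite mem_next.
by exists [set x; next (vertices s) x]%SET; [apply: imset_f|rewrite !inE eqxx].
Qed.

Lemma cycle_of_disjoint s t : below7 s -> below7 t -> uniq (s ++ t) ->
  (finset.cover (cycle_of s) :&: finset.cover (cycle_of t))%SET = finset.set0.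
Proof.
move=> s7 t7; rewrite cat_uniq => /and3P[_ /hasPn st _].
apply/setP => x; rewrite !cover_cycle_of !inE; apply/negP => /andP[xs xt].
have hv u : below7 u -> x \in vertices u -> val x \in u.
  by move=> u7 xu; rewrite -(verticesK u7) map_f.
by have := st _ (hv t t7 xt); rewrite /= (hv s s7 xs).
Qed.

(** * Realizations of subgraphs *)

Section Realization.
Variables (R : realType) (n : nat).
Implicit Types (K : {set {set 'I_n}}) (i j : 'I_n).

Definition on_edge i j (t : R) : 'rV[R]_n :=
  (1 - t) *: delta_mx ord0 i + t *: delta_mx ord0 j.

Lemma realization_on_edge K i j t : [set i; j]%SET \in K -> 0 <= t <= 1 ->
  realization K (on_edge i j t).
Proof.
move=> ijK /andP[t0 t1]; split.
- move=> k; rewrite !mxE addr_ge0// mulr_ge0 ?ler0n//; lra.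
- under eq_bigr do rewrite !mxE eqxx /=.
  rewrite big_split /= -!mulr_sumr.
  have d k : \sum_(l < n) (l == k)%:R = 1 :> R.
    by rewrite (bigD1 k)//= eqxx big1 ?addr0// => l /negbTE->.
  by rewrite !d; lra.
- exists [set i; j]%SET => // k; apply: contra_neqT; rewrite !inE negb_or => /andP[ki kj].
  by rewrite !mxE (negbTE ki) (negbTE kj) /= !mulr0 addr0.
Qed.

Lemma realization_sub K K' : {subset K <= K'} -> @realization R n K `<=` @realization R n
  K'.
Proof. by move=> s x [x0 x1 [S SK xS]]; split=> //; exists S => //; exact: s. Qed.

Lemma realization_compact K : compact (@realization R n K).
Proof.
have coord i : continuous (fun x : 'rV[R]_n => x ord0 i) := @coord_continuous R 1 n ord0 i.
apply: bounded_closed_compact.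
  exists 1; split => // M M1 x [x0 x1 _]; apply: le_trans (ltW M1).
  apply: mx_norm_le => // i; rewrite ger0_norm// -x1 (bigD1 i)//= lerDl.
  exact: sumr_ge0.
have -> : @realization R n K = (\bigcap_(i in [set: 'I_n]) [set x : 'rV[R]_n | 0 <= x ord0
  i]) `&`
    [set x : 'rV[R]_n | \sum_i x ord0 i = 1] `&`
    \big[setU/set0]_(S <- enum K) \bigcap_(i in [set i | i \notin S]) [set x : 'rV[R]_n |
      x ord0 i = 0].
  apply/seteqP; split => [x [x0 x1 [S SK xS]]|x [[x0 x1]]].
    split; first by split=> // i _; exact: x0.
    rewrite -bigcup_seq; exists S; rewrite /= ?mem_enum// => i /= iS.
    by apply/eqP; apply: contraNT iS => /xS.
  rewrite -bigcup_seq => -[S /=]; rewrite mem_enum => SK xS.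
  split=> //; first by move=> i; exact: x0.
  exists S => // i; apply: contra_neqT => iS; exact: xS.
apply: closedI; first apply: closedI.
- by apply: closed_bigI => i _; apply: (@closed_comp _ _ (fun x : 'rV[R]_n =>
  x ord0 i) [set r | 0 <= r]); [move=> x _; exact: coord|exact: closed_ge].
- apply: (@closed_comp _ _ (fun x : 'rV[R]_n => \sum_i x ord0 i) [set r | r = 1]).
    by move=> x _; apply: continuous_big => [|i _]; [exact: add_continuous|exact: coord].
  exact: closed_eq.
- apply: closed_bigsetU => S _; apply: closed_bigI => i _.
  apply: (@closed_comp _ _ (fun x : 'rV[R]_n => x ord0 i) [set r | r = 0]).
    by move=> x _; exact: coord.
  exact: closed_eq.
Qed.
End Realization.

Section CycleRealization.
Variable R : realType.

Lemma cycle_of_simplices s : below7 s -> uniq s -> cycle joined s ->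
  {subset cycle_of s <= simplices K211111}.
Proof.
move=> s7 us cs _ /imsetP[x xs ->]; apply/imsetP; exists (x, next (vertices s) x) => //.
rewrite inE /= K211111E; apply/orP; right.
have nx := next_map val_inj.
have cv : cycle joined (map val (vertices s)) by rewrite verticesK.
have := next_cycle cv (map_f val xs).
by rewrite (next_map val_inj)// -(map_inj_uniq val_inj) verticesK.
Qed.
End CycleRealization.

(** * Labels for the points of an approximation *)

Section Labels.
Local Open Scope nat_scope.

Definition sample := (nat * nat * nat)%type.

(** Besides the samples of the edges, each pair of cycles needs its own points to
    carry the contraction of one of its cycles. *)
Definition label_source := (sample + (seq nat * seq nat) * nat * sample)%type.

(** The first ten numbers are kept for the vertices of the reference drawing and for
    the three apexes. The lock prevents the encoding from being computed. *)
Definition label (w : label_source) : nat := locked (10 + choice.pickle w).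

Definition unlabel (n : nat) : option label_source :=
  locked (if n < 10 then None else choice.unpickle (n - 10)).

Lemma unlabel_lt n : n < 10 -> unlabel n = None.
Proof. by rewrite /unlabel -lock => ->. Qed.

Lemma labelK : pcancel label unlabel.
Proof.
by move=> w; rewrite /unlabel /label -!lock ltnNge leq_addr addKn choice.pickleK.
Qed.

Lemma label_inj : injective label.
Proof. exact: pcan_inj labelK. Qed.

Lemma label_ge w : 10 <= label w.
Proof. by rewrite /label -lock leq_addr. Qed.

Lemma label_apex w : label w \notin [:: 7; 8; 9].
Proof. by have := label_ge w; rewrite !inE; lia. Qed.

Variable N : nat.
Hypothesis N0 : 0 < N.

(** The [k]-th of the [N + 1] nodes along an edge. The two ends have a label that does
    not depend on the edge. *)
Definition node (e : edge) (k : nat) : sample :=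
  if k == 0 then (e.1, e.1, 0) else if k == N then (e.2, e.2, 0) else (e.1, e.2, k).

Definition sample_path (e : edge) := [seq (node e k, node e k.+1) | k <- iota 0 N].

Definition sample_label (u : sample) : nat := label (inl u).

Definition vertex_label (i : nat) := sample_label (i, i, 0).

Definition label_path (e : edge) := [seq (sample_label s.1, sample_label s.2) | s <-
  sample_path e].

Lemma sample_path_ends e (g : sample -> bool) :
  \big[addb/false]_(s <- sample_path e) (g s.1 (+) g s.2) = g (e.1, e.1, 0) (+) g (e.2,
    e.2, 0).
Proof.
rewrite big_map /=.
have tele m : \big[addb/false]_(k <- iota 0 m) (g (node e k) (+) g (node e k.+1)) =
    g (node e 0) (+) g (node e m).
  elim: m => [|m IH]; first by rewrite big_nil addbb.
  rewrite -addn1 iotaD add0n big_cat /= big_seq1 IH addn1.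
  by case: (g _); case: (g (node e m)); case: (g _).
by rewrite tele /node (gtn_eqF N0) !eqxx.
Qed.

Lemma label_path_ends e (g : nat -> bool) :
  \big[addb/false]_(s <- label_path e) (g s.1 (+) g s.2) = g (vertex_label e.1) (+) g
    (vertex_label e.2).
Proof. by rewrite big_map (sample_path_ends e (fun u => g (sample_label u))). Qed.

Lemma node_owner e k : (node e k).1.1 \in [:: e.1; e.2].
Proof. by rewrite /node !inE; do 2?[case: ifP => _] => /=; rewrite eqxx ?orbT. Qed.

Lemma node_neq e k : e.1 != e.2 -> node e k != node e k.+1.
Proof.
move=> e12; rewrite /node /=.
have [->|k0] := eqVneq k 0.
  by case: (1 == N); rewrite !xpair_eqE ?(negbTE e12)// andbF.
have [->|kN] := eqVneq k N.
  by rewrite (gtn_eqF (ltnSn _)) !xpair_eqE eq_sym (negbTE e12) andbF.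
case: (k.+1 == N); rewrite !xpair_eqE; first by rewrite (negbTE e12).
by rewrite (ltn_eqF (ltnSn k)) !andbF.
Qed.

(** Labels on disjoint edges are told apart by the vertex recorded first in them. *)
Definition owner (n : nat) : nat :=
  match unlabel n with Some (inl u) => u.1.1 | Some (inr _) => 0 | None => n end.

Lemma owner_sample u : owner (sample_label u) = u.1.1.
Proof. by rewrite /owner /sample_label labelK. Qed.

Lemma loop_owner e s : e.1 < 7 -> e.2 < 7 ->
  s \in loop vertex_label id label_path e ->
  [/\ owner s.1 \in [:: e.1; e.2], owner s.2 \in [:: e.1; e.2] & e.1 != e.2 -> s.1 != s.2].
Proof.
move=> e1 e2; have ow i : i < 7 -> owner i = i by move=> i7; rewrite /owner unlabel_lt
  ?(ltn_trans i7).
rewrite mem_cat => /orP[/mapP[x /mapP[k _ ->] ->] /=|].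
  rewrite !owner_sample !node_owner; split=> // /(node_neq k); apply: contra_neq.
  by move/label_inj => [].
have neq i : i < 7 -> vertex_label i != i.
  by move=> i7; rewrite gtn_eqF// (leq_trans _ (label_ge _))// (ltn_trans i7).
by rewrite !inE => /or3P[]/eqP-> /=; rewrite ?owner_sample !ow// ?inE !eqxx ?orbT; split=>
  // _; exact: neq.
Qed.

Lemma loop_apart7 e f : uniq [:: e.1; e.2; f.1; f.2] ->
  all (fun i => i < 7) [:: e.1; e.2; f.1; f.2] ->
  apart (loop vertex_label id label_path e) (loop vertex_label id label_path f).
Proof.
move=> u /= /and5P[e1 e2 f1 f2 _] s t /(loop_owner e1 e2)[s1 s2 ss] /(loop_owner f1 f2)[t1
  t2 tt].
move: u; rewrite /= !inE !negb_or !andbT => /and3P[/and3P[e12 e1f1 e1f2] /andP[e2f1 e2f2]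
  f12].
have sep x y : owner x \in [:: e.1; e.2] -> owner y \in [:: f.1; f.2] -> x != y.
  move=> ox oy; apply/eqP => xy; move: ox oy e1f1 e1f2 e2f1 e2f2; rewrite xy !inE.
  by move=> /orP[]/eqP-> /orP[]/eqP->; rewrite eqxx.
by rewrite ss// tt// !sep.
Qed.

Lemma loop_avoids7 e : e.1 < 7 -> e.2 < 7 ->
  avoids [:: 7; 8; 9] (loop vertex_label id label_path e).
Proof.
have ap i : i < 7 -> i \notin [:: 7; 8; 9].
  by move=> i7; rewrite !inE !negb_or !ltn_eqF// ltnW// ltnW.
move=> e1 e2 s; rewrite mem_cat => /orP[/mapP[x _ ->] /=|].
  by apply/andP; split; exact: label_apex.
rewrite in_cons => /orP[/eqP->|]; first by rewrite /= !ap.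
rewrite in_cons mem_seq1 => /orP[]/eqP->; apply/andP; split; by [exact: label_apex|exact:
  ap].
Qed.

End Labels.

(** * Positions of the sample points *)

Lemma common_lower_bound (R : realType) (A : eqType) (l : seq A) (d : A -> R) :
  (forall x, 0 < d x) -> exists2 d0, 0 < d0 & forall x, x \in l -> d0 <= d x.
Proof.
move=> dp; elim: l => [|x l [d0 d0p d0l]]; first by exists 1.
exists (Num.min d0 (d x)); first by rewrite lt_min d0p dp.
by move=> y; rewrite in_cons ge_min => /orP[/eqP->|/d0l->//]; rewrite lexx orbT.
Qed.

Definition all_pairs := pairs33 ++ pairs34.

Lemma all_pairs_ok st : st \in all_pairs ->
  [/\ uniq (st.1 ++ st.2), cycle joined st.1 && cycle joined st.2,
      (2 < size st.1)%N && (2 < size st.2)%N & below7 st.1 && below7 st.2].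
Proof.
have /allP H : all (fun st => [&& uniq (st.1 ++ st.2), cycle joined st.1 && cycle joined
  st.2,
   (2 < size st.1)%N && (2 < size st.2)%N & below7 st.1 && below7 st.2]) all_pairs by
     vm_compute.
by move=> /H/and4P[].
Qed.

Section Positions.
Variable R : realType.

Lemma on_edge_lip (n : nat) (i j : 'I_n) (s t : R) : `|on_edge i j s - on_edge i j t| <=
  `|s - t|.
Proof.
apply: mx_norm_le => // k; rewrite !mxE eqxx /=.
have -> : (1 - s) * (k == i)%:R + s * (k == j)%:R - ((1 - t) * (k == i)%:R + t * (k ==
  j)%:R)
  = (s - t) * ((k == j)%:R - (k == i)%:R) by ring.
rewrite normrM ler_piMr//.
by case: (k == i); case: (k == j); rewrite ?subrr ?subr0 ?sub0r ?normrN ?normr0 ?normr1.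
Qed.

Definition position (N : nat) (u : sample) : 'rV[R]_7 :=
  on_edge (inord u.1.1) (inord u.1.2) (u.2%:R / N%:R).

Lemma position_node N e k : (0 < N)%N -> (k <= N)%N ->
  position N (node N e k) = on_edge (inord e.1) (inord e.2) (k%:R / N%:R).
Proof.
move=> N0 kN; rewrite /position /node.
have [->|k0] := eqVneq k 0%N.
  by rewrite /on_edge /= mul0r !scale0r !addr0.
have [->|kN'] := eqVneq k N; last by [].
by rewrite /on_edge /= mul0r divff ?pnatr_eq0 -?lt0n// subrr subr0 !scale0r addr0 add0r.
Qed.

Lemma sample_path_edge N s x : (0 < N)%N -> below7 s -> uniq s -> (1 < size s)%N ->
  x \in path_cycle (sample_path N) s ->
  [/\ x.1.1.1 \in s, x.1 != x.2, realization (cycle_of s) (position N x.1),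
    realization (cycle_of s) (position N x.2) & `|position N x.1 - position N x.2| <=
      N%:R^-1].
Proof.
move=> N0 s7 us s1 /flattenP[_ /mapP[e es ->] /mapP[k]]; rewrite mem_iota add0n /= => kN ->.
have eK : edge_of e \in cycle_of s by apply/mem_cycle_of => //; exists e.
have frac m : (m <= N)%N -> 0 <= (m%:R / N%:R : R) <= 1.
  by move=> mN; rewrite divr_ge0//= ler_pdivrMr ?ltr0n// mul1r ler_nat.
have real m : (m <= N)%N -> realization (cycle_of s) (position N (node N e m)).
  by move=> mN; rewrite position_node//; apply: realization_on_edge => //; exact: frac.
split; [| |exact: real (ltnW kN)|exact: real|].
- have /andP[e1 e2] := cycle_edges_mem es.
  by have := node_owner N e k; rewrite !inE => /orP[]/eqP->.
- by apply: node_neq => //; exact: cycle_edges_neq es.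
- rewrite /= (@position_node N e k N0 (ltnW kN)) (@position_node N e k.+1 N0 kN);
  apply: le_trans (on_edge_lip _ _ _ _) _.
  by rewrite -mulrBl -addn1 natrD opprD addrA subrr sub0r mulN1r normrN ger0_norm ?invr_ge0.
Qed.
End Positions.

(** * Nine links in every embedding *)

Section LowerBound.
Variables (R : realType) (f : 'rV[R]_7 -> 'rV[R]_3).

Definition cycle_image (s : seq nat) : set 'rV[R]_3 := f @` realization (cycle_of s).

Lemma path_cycle_label N s : path_cycle (label_path N) s =
  [seq (sample_label x.1, sample_label x.2) | x <- path_cycle (sample_path N) s].
Proof. by rewrite /path_cycle map_flatten -[in RHS]map_comp. Qed.

(** On the first ring the points of [c] are its samples, so the labels of the rings
    are new ones except there. Samples that are not on [c] keep away from the rings. *)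
Lemma unlinked_pair N (P : nat -> 'rV[R]_3) d X (st : seq nat * seq nat) c c' :
  (0 < N)%N -> generic P -> below7 c -> below7 c' -> uniq (c ++ c') ->
  (1 < size c)%N -> (1 < size c')%N -> cycle joined c -> cycle joined c' ->
  0 < d -> unlinked_at_scale (cycle_image c) (cycle_image c') d X -> (forall z,
    X 0%N z = z) ->
  (forall u, `|P (sample_label u) - f (position R N u)| < d / 3) ->
  (forall k u, `|P (label (inr (st, k, u))) - X k (f (position R N u))| < d / 3) ->
  (forall y z, realization (simplices K211111) y -> realization (simplices K211111) z ->
     `|y - z| <= N%:R^-1 -> `|f y - f z| < d / 3) ->
  lk P 7 (path_cycle (label_path N) c) (path_cycle (label_path N) c') = false.
Proof.
move=> N0 gP c7 c7' ucc c1 c1' jc jc' d0 unl X0 Ps Pr uf.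
have := ucc; rewrite cat_uniq => /and3P[uc /hasPn cc' uc'].
pose rg k (u : sample) := if (k == 0)%N && (u.1.1 \in c) then sample_label u
  else label (inr (st, k, u)).
pose C := path_cycle (sample_path N) c; pose D := path_cycle (label_path N) c'.
have CP x : x \in C -> _ := sample_path_edge R N0 c7 uc c1.
have DP x : x \in path_cycle (sample_path N) c' -> _ := sample_path_edge R N0 c7' uc' c1'.
have owner2 s x : x \in path_cycle (sample_path N) s -> x.2.1.1 \in s.
  move=> /flattenP[_ /mapP[e es ->] /mapP[k _ ->]].
  have /andP[e1 e2] := cycle_edges_mem es.
  by have := node_owner N e k.+1; rewrite !inE => /orP[]/eqP->.
have rgX k u : `|P (rg k u) - X k (f (position R N u))| < d.
  have dd : d / 3 < d by lra.
  apply: lt_trans dd; rewrite /rg; case: andP => [[/eqP-> _]|_]; last exact: Pr.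
  by rewrite X0.
have -> : path_cycle (label_path N) c = ring_chain C rg 0.
  rewrite path_cycle_label; apply/eq_in_map => x xC; rewrite /rg /=.
  by have [-> _ _ _ _] := CP x xC; rewrite owner2.
have DE t : t \in D -> exists2 x, x \in path_cycle (sample_path N) c' &
    t = (sample_label x.1, sample_label x.2).
  by rewrite /D path_cycle_label => /mapP[x xD ->]; exists x.
have simp s (y : 'rV[R]_7) : below7 s -> uniq s -> cycle joined s ->
  realization (cycle_of s) y ->
    realization (simplices K211111) y by move=> s7 us js; apply: realization_sub;
      exact: cycle_of_simplices.
apply: (unl _ _ P 7%N 8%N 9%N C D rg (fun u => f (position R N u))) => //.
- exact: (closed_path_cycle (va := fun i => (i, i, 0%N)) (sample_path_ends N0)).
- exact: (closed_path_cycle (va := vertex_label) (label_path_ends N0)).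
- move=> k l u v; rewrite /rg; case: andP => [[/eqP-> uC]|nu]; case: andP => [[/eqP->
  vC]|nv] /label_inj //.
  + by case=> ->.
  + by case=> -> ->.
- by move=> k u; rewrite /rg; case: ifP => _; exact: label_apex.
- by move=> t /DE[x _ ->]; rewrite !label_apex.
- by move=> x /CP[].
- move=> t k u /DE[x xD ->] /=.
  have [x1 x12 _ _ _] := DP x xD; have x2 := owner2 _ _ xD.
  have nrg y : y.1.1 \in c' -> sample_label y != rg k u.
    move=> yc'; rewrite /rg; case: andP => [[_ uC]|_]; last by apply/eqP => /label_inj.
    by apply: contraTneq uC => /label_inj[<-]; have := cc' _ yc'.
  by rewrite !nrg//; split=> //; apply: contra_neq x12 => /label_inj[].
- move=> x xC; have [_ _ x1 x2 x12] := CP x xC; split; [by exists (position R N x.1)|by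
  exists (position R N x.2)|].
  by apply: lt_trans (uf _ _ _ _ x12) _; [exact: simp x1|exact: simp x2|lra].
- move=> t /DE[x xD ->] /=; have [_ _ x1 x2 x12] := DP x xD; split; last first.
    exists (f (position R N x.1)); first by exists (position R N x.1).
    by apply: lt_trans (Ps _) _; lra.
  have h1 := Ps x.1; have h2 := Ps x.2.
  have h3 := uf _ _ (simp _ _ c7' uc' jc' x1) (simp _ _ c7' uc' jc' x2) x12.
  have := ler_distD (f (position R N x.1)) (P (sample_label x.1)) (P (sample_label x.2)).
  have := ler_distD (f (position R N x.2)) (f (position R N x.1)) (P (sample_label x.2)).
  by rewrite (distrC (f (position R N x.2)) (P _)); lra.
Qed.

Hypothesis cf : {within realization (simplices K211111), continuous f}.

Lemma cycle_image_compact s : below7 s -> uniq s -> cycle joined s ->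
  compact (cycle_image s).
Proof.
move=> s7 us js; apply: continuous_compact; last exact: realization_compact.
apply: continuous_subspaceW cf.
by apply: realization_sub; exact: cycle_of_simplices.
Qed.

Lemma cycle_image_neq0 s : below7 s -> uniq s -> (0 < size s)%N -> cycle_image s !=set0.
Proof.
move=> s7 us; case sE : s => [//|x s'] _; rewrite -sE in s7 us *.
have xs : x \in s by rewrite sE mem_head.
exists (f (on_edge (inord (ordered_edge x (next s x)).1) (inord (ordered_edge x (next s
  x)).2) 0)).
exists (on_edge (inord (ordered_edge x (next s x)).1) (inord (ordered_edge x (next s
  x)).2) 0) => //.
apply: realization_on_edge; last by rewrite lexx ler01.
by apply/(mem_cycle_of _ s7 us); exists (ordered_edge x (next s x)) => //; exact: map_f.
Qed.

Definition scale_data : Type := R * (nat -> 'rV[R]_3 -> 'rV[R]_3) * bool.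

Lemma split_scale_data (L M : set 'rV[R]_3) : L !=set0 -> M !=set0 -> compact L ->
  compact M ->
  exists y : scale_data, [/\ 0 < y.1.1, forall z, y.1.2 0%N z = z & split_link L M ->
    if y.2 then unlinked_at_scale L M y.1.1 y.1.2 else unlinked_at_scale M L y.1.1 y.1.2].
Proof.
move=> L0 M0 cL cM; have [sp|nsp] := pselect (split_link L M); last first.
  by exists (1, (fun _ z => z), true).
have cl (A : set 'rV[R]_3) : compact A -> closed A by apply: compact_closed;
  exact: norm_hausdorff.
have [h [g [ch cg hK gK [[gL gM]|[gM gL]]]]] := split_inside_outside L0 M0 sp.
  have [d [X [d0 X0 H]]] := contracted_unlinked ch cg hK gK cL (cl _ cM) gL gM.
  by exists (d, X, true).
have [d [X [d0 X0 H]]] := contracted_unlinked ch cg hK gK cM (cl _ cL) gM gL.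
by exists (d, X, false).
Qed.

(** A single configuration has to serve all pairs of cycles: for each pair separated
    by a sphere, choose a contraction and its precision, then sample and perturb with
    the finest of these finitely many precisions. *)
Theorem linking_parities : exists l : seq nat * seq nat -> bool,
  (forall S, all is_cycle_pair S -> even_cover S ->
    \big[addb/false]_(st <- S) l st = \big[addb/false]_(st <- S) moment_lk st) /\
  (forall st, st \in all_pairs -> l st ->
     ~ split_link (cycle_image st.1) (cycle_image st.2)).
Proof.
pose Q st (y : scale_data) := [/\ 0 < y.1.1, forall z, y.1.2 0%N z = z &
  st \in all_pairs -> split_link (cycle_image st.1) (cycle_image st.2) ->
    if y.2 then unlinked_at_scale (cycle_image st.1) (cycle_image st.2) y.1.1 y.1.2
    else unlinked_at_scale (cycle_image st.2) (cycle_image st.1) y.1.1 y.1.2].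
have /choice[dat datP] : forall st, exists y, Q st y.
  move=> st; have [stp|nst] := boolP (st \in all_pairs); last first.
    by exists (1, (fun _ z => z), true); split=> // stp; rewrite stp in nst.
  have [] := all_pairs_ok stp; rewrite cat_uniq => /and3P[u1 _ u2] /andP[j1 j2] /andP[s1
    s2] /andP[b1 b2].
  have [y [y0 yX ys]] := split_scale_data (cycle_image_neq0 b1 u1 (ltnW (ltnW s1)))
    (cycle_image_neq0 b2 u2 (ltnW (ltnW s2))) (cycle_image_compact b1 u1 j1)
      (cycle_image_compact b2 u2 j2).
  by exists y.
have dat0 st : 0 < (dat st).1.1 by have [] := datP st.
have [d d0 dle] := common_lower_bound all_pairs dat0.
have d3 : 0 < d / 3 by rewrite divr_gt0.
have [m m0 um] := compact_uniform_continuous (@realization_compact R 7 (simplices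
  K211111)) cf d3.
pose N := (Num.bound m^-1).+1.
have Nm : N%:R^-1 < m.
  rewrite invf_plt ?posrE//; apply: lt_le_trans (archi_boundP _) _;
    first by rewrite invr_ge0 ltW.
  by rewrite ler_nat.
have N0 : (0 < N)%N by [].
(* Labels below 10 are sent to the origin, where the perturbation
   turns them into a small copy of the moment curve. *)
pose x (n : nat) : 'rV[R]_3 := match unlabel n with
  | Some (inl u) => f (position R N u)
  | Some (inr (st, k, u)) => (dat st).1.2 k (f (position R N u))
  | None => 0 end.
have [t /andP[t0 td] gP] := generic_perturbation x d3.
pose P k := x k + t *: moment R k; rewrite -/P in gP.
have Px n : `|P n - x n| < d / 3.
  rewrite /P addrAC subrr add0r normrZ gtr0_norm//; apply: le_lt_trans td.
  apply: ler_piMr (ltW t0) _; apply: mx_norm_le => // i; rewrite !mxE.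
  rewrite ger0_norm ?exprn_ge0 ?invr_ge0//.
  by rewrite exprn_ile1 ?invr_ge0// invf_le1 ?ltr0n// ler1n.
have Ps u : `|P (sample_label u) - f (position R N u)| < d / 3.
  by have := Px (sample_label u); rewrite /x labelK.
have Pr st k u : `|P (label (inr (st, k, u))) - (dat st).1.2 k (f (position R N u))| < d /
  3.
  by have := Px (label (inr (st, k, u))); rewrite /x labelK.
have Pbase n : (n < 10)%N -> P n = t *: moment R n.
  by move=> n10; rewrite /P /x unlabel_lt// add0r.
exists (fun st => lk P 7 (path_cycle (label_path N) st.1) (path_cycle (label_path N) st.2)).
split=> [S cS eS|st stp + sp].
  have la e g := label_path_ends N0 e g.
  have := lk_even_cover gP (p := 7%N) (q := 8%N) (r := 9%N) isT la (@loop_apart7 N)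
    (@loop_avoids7 N) cS eS.
  move=> ->; apply: eq_big_seq => -[s1 s2] /(allP cS)/= /and5P[u l1 l2 b1 b2].
  have H (l : seq bool) : foldr addb false l = \big[addb/false]_(b <- l) b.
    by elim: l => [|b l IH]; rewrite ?big_nil// big_cons -IH.
  rewrite /moment_lk H big_map big_allpairs_dep /lk big_map; apply: eq_big_seq => e es1.
  rewrite big_map; apply: eq_big_seq => g gs2.
  have := uniq_cross u l1 l2 es1 gs2.
  have [e1 e2] := cycle_edges_dom b1 es1; have [g1 g2] := cycle_edges_dom b2 gs2 => uq.
  rewrite /hits /= !Pbase ?(ltn_trans e1) ?(ltn_trans e2) ?(ltn_trans g1) ?(ltn_trans g2)//.
  apply: hit_moment => //; move: uq; rewrite /= !inE !negb_or !andbT.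
  move=> /and3P[/and3P[h1 h2 h3] /andP[h4 h5] h6].
  by rewrite h1 h2 h3 h4 h5 h6 !(ltn_eqF e1, ltn_eqF e2, gtn_eqF g1, gtn_eqF g2).
have path_loop s y : y \in path_cycle (label_path N) s ->
    exists2 e, e \in cycle_edges s & y \in loop vertex_label id (label_path N) e.
  by move=> /flattenP[_ /mapP[e es ->] ye]; exists e; rewrite // mem_cat ye.
have [] := all_pairs_ok stp; rewrite cat_uniq => /and3P[u1 u12 u2] /andP[j1 j2] /andP[s1
  s2] /andP[b1 b2].
have [_ X0 /(_ stp sp)] := datP st; have le := dle st stp.
have ust : uniq (st.1 ++ st.2) by rewrite cat_uniq u1 u12 u2.
have uts : uniq (st.2 ++ st.1) by rewrite uniq_catC.
have le3 : d / 3 <= (dat st).1.1 / 3 by rewrite ler_pM2r.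
have uf : forall y z, realization (simplices K211111) y -> realization (simplices K211111)
  z ->
     `|y - z| <= N%:R^-1 -> `|f y - f z| < (dat st).1.1 / 3.
  by move=> y z ry rz yz; apply: lt_le_trans (um y z ry rz (le_lt_trans yz Nm)) le3.
have Ps' u := lt_le_trans (Ps u) le3; have Pr' k u := lt_le_trans (Pr st k u) le3.
case: ifP => _ unl.
  by rewrite (unlinked_pair N0 gP b1 b2 ust (ltnW s1) (ltnW s2) j1 j2 (dat0 st) unl X0 Ps'
    Pr' uf).
rewrite (lk_sym gP (p := 7%N) (q := 8%N) (r := 9%N)) //.
- by rewrite (unlinked_pair N0 gP b2 b1 uts (ltnW s2) (ltnW s1) j2 j1 (dat0 st) unl X0 Ps'
  Pr' uf).
- exact: (closed_path_cycle (va := vertex_label) (label_path_ends N0)).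
- exact: (closed_path_cycle (va := vertex_label) (label_path_ends N0)).
- move=> y z /path_loop[e e1 ye] /path_loop[g g2 zg].
  have [h1 h2] := cycle_edges_dom b1 e1; have [h3 h4] := cycle_edges_dom b2 g2.
  apply: (loop_apart7 _ _ ye zg); last by rewrite /= h1 h2 h3 h4.
  exact: (uniq_cross ust (ltnW s1) (ltnW s2) e1 g2).
- by move=> y /path_loop[e /(cycle_edges_dom b1)[h1 h2]]; apply: loop_avoids7.
- by move=> y /path_loop[e /(cycle_edges_dom b2)[h1 h2]]; apply: loop_avoids7.
Qed.
End LowerBound.

Definition pair_of (st : seq nat * seq nat) : {set {set {set 'I_7}}} :=
  [set cycle_of st.1; cycle_of st.2]%SET.

Definition same_edges (s t : seq nat) : bool := all (fun e =>
  e \in cycle_edges t) (cycle_edges s).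

Lemma pair_of_inj : {in all_pairs &, injective pair_of}.
Proof.
have /allP H : all (fun st => all (fun uv => (st == uv) || ~~ (same_edges st.1 uv.1 &&
  same_edges st.2 uv.2
  || same_edges st.1 uv.2 && same_edges st.2 uv.1)) all_pairs) all_pairs by vm_compute.
move=> st uv stp uvp E; have /(_ uv uvp)/orP[/eqP//|/negP[]] := allP (H st stp).
have [u1 _ _ /andP[s1 s2]] := all_pairs_ok stp; have [u2 _ _ /andP[v1 v2]] := all_pairs_ok
  uvp.
move: u1 u2; rewrite !cat_uniq => /and3P[us _ ut] /and3P[uu _ uv'].
have same s t : below7 s -> below7 t -> uniq s -> uniq t -> cycle_of s = cycle_of t ->
  same_edges s t.
  by move=> *; exact: cycle_of_inj.
have m1 : cycle_of st.1 \in pair_of uv by rewrite -E !inE eqxx.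
have m2 : cycle_of st.2 \in pair_of uv by rewrite -E !inE eqxx orbT.
have m3 : cycle_of uv.1 \in pair_of st by rewrite E !inE eqxx.
have m4 : cycle_of uv.2 \in pair_of st by rewrite E !inE eqxx orbT.
move: m1 m2 m3 m4; rewrite !inE => /orP[/eqP e1|/eqP e1] /orP[/eqP e2|/eqP e2] /orP[/eqP
  e3|/eqP e3] /orP[/eqP e4|/eqP e4];
  apply/orP; (try by left; apply/andP; split; apply: same => //; congruence);
  by right; apply/andP; split; apply: same => //; congruence.
Qed.

Section Count.
Variables (R : realType) (f : 'rV[R]_7 -> 'rV[R]_3).

Lemma is_link_pair st : st \in all_pairs ->
  ~ split_link (cycle_image f st.1) (cycle_image f st.2) -> is_link K211111 f (pair_of st).
Proof.
move=> stp ns; have [u /andP[j1 j2] /andP[l1 l2] /andP[s1 s2]] := all_pairs_ok stp.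
have := u; rewrite cat_uniq => /and3P[u1 _ u2].
exists (cycle_of st.1), (cycle_of st.2); split=> //; last exact: cycle_of_disjoint.
- exact: is_cycle_of.
- exact: is_cycle_of.
Qed.

Lemma nine_links : {within realization (simplices K211111), continuous f} ->
  (9 <= link_count K211111 f)%N.
Proof.
move=> /linking_parities[l [/nine_odd_pairs + lns]]; rewrite -/all_pairs -size_filter.
set L := [seq st <- all_pairs | l st] => l9; apply: leq_trans l9 _.
have sub : {subset L <= all_pairs} by move=> st; rewrite mem_filter => /andP[].
rewrite -(size_map pair_of) /link_count cardE; apply: uniq_leq_size.
  rewrite map_inj_in_uniq; last by move=> x y /sub xp /sub yp; exact: pair_of_inj.
  by apply: filter_uniq; vm_compute.
move=> _ /mapP[st + ->]; rewrite mem_filter => /andP[lst stp].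
rewrite mem_enum inE; apply/asboolP/is_link_pair => //; exact: lns.
Qed.
End Count.

(** * Spheres around star-shaped sets *)

Section Radial.
Variable R : realType.
Notation E := ('rV[R]_3).

Definition positively_homogeneous (a : E -> R) :=
  forall (c : R) x, 0 < c -> a (c *: x) = c * a x.

Definition radial (a b : E -> R) (x : E) : E := (a x / b x) *: x.

(** At the origin, boundedness of the ratio is enough. *)
Lemma radial_continuous (a b : E -> R) (K : R) : continuous a -> continuous b ->
  (forall x, x != 0 -> b x != 0) -> 0 < K -> (forall x, `|a x / b x| <= K) ->
  continuous (radial a b).
Proof.
move=> ca cb b0 K0 abK x; have [->|x0] := eqVneq x 0.
  move=> A; rewrite {1}/radial scaler0 => /nbhs_ballP[e /= e0 eA].
  apply/nbhs_ballP; exists (e / K); first by rewrite /= divr_gt0.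
  move=> y; rewrite -ball_normE /= sub0r normrN ltr_pdivlMr// mulrC => yK; apply: eA.
  rewrite -ball_normE /= sub0r normrN /radial normrZ; apply: le_lt_trans yK.
  by rewrite ler_wpM2r.
have cid : {for x, continuous (fun y : E => y)} by move=> A.
exact: (continuousZ (continuousM (ca x) (continuousV (b0 x x0) (cb x))) cid).
Qed.

Lemma shift_continuous (f : E -> E) (v : E) : continuous f -> continuous (fun x => f x + v).
Proof.
move=> cf x; have cv : {for x, continuous (fun _ : E => v)} by exact: cst_continuous.
exact: (continuousD (cf x) cv).
Qed.

Lemma translate_continuous (v : E) : continuous (fun x : E => x + v).
Proof. by apply: (@shift_continuous id) => x A. Qed.

Lemma continuous_translate (T : topologicalType) (F : E -> T) (v : E) :
  continuous F -> continuous (fun x : E => F (x + v)).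
Proof.
by move=> cF x; exact: (@continuous_comp _ _ _ (fun x : E => x + v) F x
  (@translate_continuous v x) (cF _)).
Qed.

Lemma radialK (a b : E -> R) : positively_homogeneous a -> positively_homogeneous b ->
  (forall x, x != 0 -> 0 < a x) -> (forall x, x != 0 -> 0 < b x) ->
  cancel (radial a b) (radial b a).
Proof.
move=> ha hb a0 b0 x; have [->|x0] := eqVneq x 0; first by rewrite /radial !scaler0.
have c0 : 0 < a x / b x by rewrite divr_gt0 ?a0 ?b0.
rewrite /radial ha// hb// scalerA -[RHS]scale1r; congr (_ *: _).
by have := a0 x x0; have := b0 x x0; move=> /lt0r_neq0 h1 /lt0r_neq0 h2; field;
  rewrite h1 h2.
Qed.

Definition euclid (x : E) : R := Num.sqrt (dot x x).

Lemma euclid_continuous : continuous euclid.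
Proof.
by move=> x; apply: continuous_comp; [exact: dot_continuous|exact: sqrt_continuous].
Qed.

Lemma euclid_homogeneous : positively_homogeneous euclid.
Proof.
move=> c x c0; have -> : euclid (c *: x) = Num.sqrt (c ^+ 2 * dot x x).
  by congr Num.sqrt; rewrite /dot !mxE; ring.
by rewrite sqrtrM ?sqr_ge0// sqrtr_sqr gtr0_norm.
Qed.

Lemma norm_le_euclid x : `|x| <= euclid x.
Proof.
apply: mx_norm_le => [|i]; first exact: sqrtr_ge0.
rewrite -sqrtr_sqr ler_wsqrtr// /dot; case: (ord3P i) => ->; nra.
Qed.

Lemma euclid_le_norm x : euclid x <= 2 * `|x|.
Proof.
rewrite -[leRHS]ger0_norm ?mulr_ge0// -sqrtr_sqr ler_wsqrtr//.
have h i : x ord0 i * x ord0 i <= `|x| ^+ 2.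
  by rewrite -expr2 -real_normK ?num_real// ler_sqr ?nnegrE// coord_le_norm.
by rewrite /dot exprMn; have := h o0; have := h o1; have := h o2; have := sqr_ge0 `|x|; lra.
Qed.

Lemma euclid_gt0 x : x != 0 -> 0 < euclid x.
Proof. by move=> x0; apply: lt_le_trans (norm_le_euclid x); rewrite normr_gt0. Qed.

(** Stretching each ray from the origin by [euclid x / g x] maps the round sphere to
    the level set of [g]. *)
Lemma split_by_gauge (o : E) (g : E -> R) (B C : R) (L M : set E) :
  continuous g -> positively_homogeneous g -> 0 < B -> 0 < C ->
  (forall x, `|x| <= B * g x) -> (forall x, g x <= C * `|x|) ->
  (forall x, L x -> g (x - o) < 1) -> (forall x, M x -> 1 < g (x - o)) ->
  split_link L M.
Proof.
move=> cg hg B0 C0 gB gC Lg Mg.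
have g0 x : x != 0 -> 0 < g x.
  by move=> x0; have := gB x; rewrite -(pmulr_rgt0 _ B0); apply: lt_le_trans;
    rewrite normr_gt0.
have gge0 x : 0 <= g x by rewrite -(pmulr_rge0 _ B0); apply: le_trans (gB x).
have ne_gt0 x : x != 0 -> g x != 0 by move/g0/lt0r_neq0.
have nE_gt0 x : x != 0 -> euclid x != 0 by move/euclid_gt0/lt0r_neq0.
pose h x := radial euclid g x + o.
pose k x := radial g euclid (x - o).
have ch : continuous h.
  apply: shift_continuous; apply: (@radial_continuous _ _ (2 * B)) => //;
    [exact: euclid_continuous|by rewrite mulr_gt0|].
  move=> y; rewrite ger0_norm; last by rewrite divr_ge0 ?sqrtr_ge0.
  have [->|y0] := eqVneq y 0.
    by rewrite /euclid /dot !mxE !mul0r !addr0 sqrtr0 mul0r mulr_ge0// ltW.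
  rewrite ler_pdivrMr ?g0// -mulrA; apply: le_trans (euclid_le_norm y) _.
  by rewrite ler_pM2l.
have ck : continuous k.
  apply: (@continuous_translate _ (radial g euclid)).
  apply: (@radial_continuous _ _ C) => //; first exact: euclid_continuous.
  move=> y; rewrite ger0_norm; last by rewrite divr_ge0 ?sqrtr_ge0.
  have [->|y0] := eqVneq y 0.
    by rewrite /euclid /dot !mxE !mul0r !addr0 sqrtr0 invr0 mulr0 ltW.
  rewrite ler_pdivrMr ?euclid_gt0//; apply: le_trans (gC y) _.
  by rewrite ler_pM2l// norm_le_euclid.
have hK : cancel h k.
  move=> x; rewrite /k /h addrK.
  by apply: radialK => //; [exact: euclid_homogeneous|exact: euclid_gt0].
have kK : cancel k h.
  move=> x; rewrite /k /h radialK //; last exact: euclid_gt0.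
    by rewrite subrK.
  exact: euclid_homogeneous.
have SE x : (h @` @unit_sphere R) x <-> g (x - o) = 1.
  split=> [[y]|gx].
    rewrite unit_sphereE => y1 <-; have ey : euclid y = 1 by rewrite /euclid y1 sqrtr1.
    have y0 : y != 0 by apply/eqP => y0; move: y1; rewrite y0 /dot !mxE; lra.
    by rewrite /h addrK /radial ey hg ?divr_gt0 ?g0// mul1r mulVf ?ne_gt0.
  exists (k x); last exact: kK.
  rewrite unit_sphereE; have x0 : x - o != 0.
    by apply/eqP => x0; have := gC (x - o); rewrite gx x0 normr0 mulr0; lra.
  have e1 : euclid (k x) = 1.
    rewrite /k /radial euclid_homogeneous; last by rewrite divr_gt0 ?g0 ?euclid_gt0.
    by rewrite divfK ?nE_gt0.
  by rewrite -[LHS]sqr_sqrtr ?dot_ge0// -/(euclid _) e1 expr1n.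
exists (h @` @unit_sphere R); split.
- by exists h => //; split=> //; exists k.
- by move=> x /Lg lt /SE E; rewrite E ltxx in lt.
- by move=> x /Mg lt /SE E; rewrite E ltxx in lt.
move=> x y /Lg gx /Mg gy [A [Ax AS cA] Ay].
have cG : {within A, continuous (fun z => g (z - o))}.
  exact/continuous_subspaceT/continuous_translate.
have /connected_intervalP itv := connected_continuous_connected cA cG.
have [z Az gz] : ((fun z => g (z - o)) @` A) 1.
  by apply: (itv (g (x - o)) (g (y - o))); [exists x|exists y|rewrite !ltW].
by apply: (AS z Az); apply/SE.
Qed.

End Radial.

Section StarShaped.
Variable R : realType.
Notation E := ('rV[R]_3).

Definition star_shaped (o : E) (T : set E) :=
  T o /\ forall (x : E) (s : R), T x -> 0 <= s <= 1 -> T ((1 - s) *: o + s *: x).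

Section Gauge.
Variables (U : set E) (e B : R).
Hypotheses (e0 : 0 < e) (B0 : 0 < B).
Hypothesis U_ball : forall x b s, U x -> `|b| < e -> 0 <= s <= 1 ->
  U ((1 - s) *: x + s *: b).
Hypothesis U_bound : forall x, U x -> `|x| <= B.
Hypothesis U0 : U 0.

Definition gauge_set (x : E) : set R := [set r | 0 < r /\ U (r^-1 *: x)].

(** The Minkowski functional of [U]. As [U] need not be convex, [U_ball] takes the
    place of convexity: [U] is star-shaped with respect to each point of a ball. *)
Definition gauge (x : E) : R := inf (gauge_set x).

Lemma gauge_set_norm x r : `|x| < e * r -> gauge_set x r.
Proof.
move=> xr; have r0 : 0 < r by rewrite -(pmulr_rgt0 _ e0); apply: le_lt_trans xr.
split=> //; have := @U_ball 0 (r^-1 *: x) 1 U0; rewrite subrr scale0r add0r scale1r.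
apply; last by rewrite ler01 lexx.
by rewrite normrZ gtr0_norm ?invr_gt0// mulrC ltr_pdivrMr.
Qed.

Lemma gauge_set_shift x y r s : 0 < s -> gauge_set x r -> `|y - x| < e * s ->
  gauge_set y (r + s).
Proof.
move=> s0 [r0 Ux] yx; split; first by rewrite addr_gt0.
have rs : 0 < r + s by rewrite addr_gt0.
have := @U_ball (r^-1 *: x) (s^-1 *: (y - x)) (s / (r + s)) Ux.
have -> : (1 - s / (r + s)) *: (r^-1 *: x) + (s / (r + s)) *: (s^-1 *: (y - x)) = (r +
  s)^-1 *: y.
  rewrite !scalerA; have -> : (1 - s / (r + s)) / r = (r + s)^-1.
    by field; rewrite !lt0r_neq0.
  have -> : s / (r + s) / s = (r + s)^-1 by field; rewrite !lt0r_neq0.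
  by rewrite -scalerDr [x + _]addrC subrK.
apply.
  by rewrite normrZ gtr0_norm ?invr_gt0// mulrC ltr_pdivrMr.
by apply/andP; split; [rewrite divr_ge0 ?ltW|rewrite ler_pdivrMr// mul1r lerDr ltW].
Qed.

Lemma gauge_has_inf x : has_inf (gauge_set x).
Proof.
split; last by exists 0 => r [/ltW].
exists ((`|x| + 1) / e); apply: gauge_set_norm.
by rewrite mulrC divfK ?lt0r_neq0// ltrDl.
Qed.

Lemma gauge_le x r : gauge_set x r -> gauge x <= r.
Proof. by move=> gr; apply: ge_inf => //; have [] := gauge_has_inf x. Qed.

Lemma gauge_gt x r : gauge x < r -> exists2 s, gauge_set x s & s < r.
Proof. by move=> gr; have [s xs sr] := inf_lt (proj1 (gauge_has_inf x)) gr; exists s. Qed.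

Lemma gauge_lip x y : gauge y - gauge x <= e^-1 * `|y - x|.
Proof.
apply/ler_addgt0Pr => d d0; rewrite lerBlDr.
have d2 : 0 < d / 2 by rewrite divr_gt0.
have [r xr rd] : exists2 r, gauge_set x r & r < gauge x + d / 2 by apply: gauge_gt; lra.
have /gauge_le : gauge_set y (r + (e^-1 * `|y - x| + d / 2)).
  apply: gauge_set_shift xr _.
    by rewrite ltr_wpDl// mulr_ge0// invr_ge0 ltW.
  rewrite mulrDr mulrA divff ?lt0r_neq0// mul1r ltrDl mulr_gt0//.
by move/le_trans; apply; lra.
Qed.

Lemma gauge_continuous : continuous gauge.
Proof.
move=> x A /nbhs_ballP[d /= d0 dA]; apply/nbhs_ballP; exists (e * d);
  first by rewrite /= mulr_gt0.
move=> y; rewrite -ball_normE /= => xy; apply: dA; rewrite -ball_normE /=.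
have h : e^-1 * `|x - y| < d by rewrite mulrC ltr_pdivrMr// mulrC.
rewrite ltr_norml; apply/andP; split.
  by have := gauge_lip x y; rewrite (distrC y); lra.
by have := gauge_lip y x; lra.
Qed.

Lemma gauge_homogeneous : positively_homogeneous gauge.
Proof.
have le c x : 0 < c -> gauge (c *: x) <= c * gauge x.
  move=> c0; rewrite mulrC -ler_pdivrMr//; apply: lb_le_inf; first by have [] :=
    gauge_has_inf x.
  move=> r [r0 Ur]; rewrite ler_pdivrMr//; apply: gauge_le; split;
    first by rewrite mulr_gt0.
  by rewrite scalerA invfM -mulrA mulVf ?lt0r_neq0// mulr1.
move=> c x c0; apply/eqP; rewrite eq_le le//= -ler_pdivlMl//.
apply: le_trans (le _ _ _); last by rewrite invr_gt0.
by rewrite scalerA mulVf ?lt0r_neq0// scale1r.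
Qed.

Lemma gauge_lower x : `|x| <= B * gauge x.
Proof.
rewrite mulrC -ler_pdivrMr//; apply: lb_le_inf; first by have [] := gauge_has_inf x.
move=> r [r0 /U_bound]; rewrite normrZ gtr0_norm ?invr_gt0// mulrC ler_pdivrMr// => h.
by rewrite ler_pdivrMr// mulrC.
Qed.

Lemma gauge_upper x : gauge x <= (2 / e) * `|x|.
Proof.
have := gauge_lip 0 x; rewrite subr0.
have : gauge 0 <= 0.
  apply/ler_addgt0Pr => d d0; rewrite add0r; apply: gauge_le; apply: gauge_set_norm.
  by rewrite normr0 mulr_gt0.
have : 0 <= e^-1 * `|x| by rewrite mulr_ge0// invr_ge0 ltW.
by rewrite -mulrA; lra.
Qed.
End Gauge.

(** The open neighbourhood of [T] by half the distance to [M] is star-shaped with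
    respect to a ball, and its gauge is less than 1 on [L] and more than 1 on [M]. *)
Lemma split_star_shaped (o : E) (T L M : set E) : star_shaped o T -> compact T ->
  closed M -> L `<=` T -> T `&` M = set0 -> split_link L M.
Proof.
move=> [To starT] cT cM LT TM0.
have [d d0 dist] := compact_closed_dist cT cM TM0.
pose e := d / 2; have e0 : 0 < e by rewrite divr_gt0.
pose U : set E := [set z | exists2 x, T x & `|o + z - x| < e].
have U0 : U 0 by exists o => //; rewrite addr0 subrr normr0.
have U_ball x b s : U x -> `|b| < e -> 0 <= s <= 1 -> U ((1 - s) *: x + s *: b).
  move=> [y Ty yx] be /andP[s0 s1]; exists ((1 - (1 - s)) *: o + (1 - s) *: y).
    by apply: starT => //; lra.
  have -> : o + ((1 - s) *: x + s *: b) - ((1 - (1 - s)) *: o + (1 - s) *: y)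
     = (1 - s) *: (o + x - y) + s *: b by apply/rowP => i; rewrite !mxE; ring.
  apply: le_lt_trans (ler_normD _ _) _; rewrite !normrZ !ger0_norm//; last by lra.
  have [->|s0'] := eqVneq s 0; first by rewrite subr0 mul1r mul0r addr0.
  have sp : 0 < s by rewrite lt_neqAle eq_sym s0'.
  have : s * `|b| < s * e by rewrite ltr_pM2l.
  have : (1 - s) * `|o + x - y| <= (1 - s) * e by apply: ler_wpM2l; [lra|exact: ltW].
  by lra.
have [K [Kreal KT]] := compact_bounded cT.
pose B := `|K| + 1 + e + `|o|; have B0 : 0 < B.
  by apply: ltr_wpDr => //; apply: addr_gt0 => //; apply: ltr_wpDl.
have U_bound x : U x -> `|x| <= B.
  move=> [y Ty yx]; have yK : `|y| <= `|K| + 1.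
    by apply: (KT (`|K| + 1)) => //; apply: le_lt_trans (ler_norm K) _; rewrite ltrDl.
  have -> : x = (o + x - y) + y - o by apply/rowP => i; rewrite !mxE; ring.
  have := ler_normB (o + x - y + y) o; have := ler_normD (o + x - y) y.
  move: yx yK; rewrite /B; set k := `|K|; set n := `|o|; move=> *; lra.
have C0 : 0 < 2 / e by rewrite divr_gt0.
apply: (@split_by_gauge _ o (gauge U) B (2 / e)) => //.
- exact: (gauge_continuous e0 U_ball U0).
- exact: (gauge_homogeneous e0 U_ball U0).
- exact: (gauge_lower e0 B0 U_ball U_bound U0).
- exact: (gauge_upper e0 U_ball U0).
- move=> x Lx; have Tx := LT x Lx; pose h := e / (`|x - o| + 1).
  have n1 : 0 < `|x - o| + 1 by have := normr_ge0 (x - o); lra.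
  have h0 : 0 < h by rewrite divr_gt0.
  have h1 : 0 < 1 + h by lra.
  have : gauge_set U ((1 + h) *: (x - o)) 1.
    split=> //; rewrite invr1 scale1r; exists x => //.
    have -> : o + (1 + h) *: (x - o) - x = h *: (x - o) by apply/rowP => i; rewrite !mxE;
      ring.
    by rewrite normrZ gtr0_norm// /h mulrAC ltr_pdivrMr// ltr_pM2l// ltrDl.
  move/(gauge_le e0 U_ball U0); rewrite (gauge_homogeneous e0 U_ball U0)// => h2.
  have : 0 <= gauge U (x - o).
    by rewrite -(pmulr_rge0 _ B0); apply: le_trans (gauge_lower e0 B0 U_ball U_bound U0 _).
  rewrite le_eqVlt => /orP[/eqP<-|g0]; first by rewrite ltr01.
  by apply: lt_le_trans h2; rewrite ltr_pMl//; lra.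
- move=> y My; rewrite ltNge; apply/negP => g1; set z := y - o in g1.
  pose h := e / (`|z| + 1).
  have n1 : 0 < `|z| + 1 by have := normr_ge0 z; lra.
  have h0 : 0 < h by rewrite divr_gt0.
  have [r [r0 Ur] rh] : exists2 r, gauge_set U z r & r < 1 + h.
    by apply: (gauge_gt e0 U_ball U0); lra.
  have far x : T x -> `|o + z - x| < d -> False.
    by move=> Tx; rewrite /z (addrC o) subrK distrC ltNge dist.
  have [r1|r1] := leP r 1.
    have : U ((1 - (1 - r)) *: (r^-1 *: z) + (1 - r) *: 0).
      by apply: U_ball => //; [rewrite normr0|lra].
    rewrite scaler0 addr0 scalerA (_ : (1 - (1 - r)) / r = 1) ?scale1r; last by field;
      rewrite lt0r_neq0.
    by move=> [x Tx xz]; apply: (far x Tx); move: xz; rewrite /e; lra.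
  have [x Tx xz] := Ur; apply: (far x Tx).
  have -> : o + z - x = (o + r^-1 *: z - x) + (1 - r^-1) *: z by apply/rowP => i;
    rewrite !mxE; ring.
  apply: le_lt_trans (ler_normD _ _) _.
  have rV : r^-1 <= 1 by rewrite invf_le1// ltW.
  have : `|(1 - r^-1) *: z| <= e.
    rewrite normrZ ger0_norm; last by lra.
    apply: (@le_trans _ _ (h * (`|z| + 1))); last by rewrite divfK// lt0r_neq0.
    apply: ler_pM => //; [lra| |lra].
    have : r * (1 - r^-1) = r - 1 by rewrite mulrBr mulr1 divff// lt0r_neq0.
    have : 1 - r^-1 <= r * (1 - r^-1) by apply: ler_peMl; lra.
    by lra.
  by move: xz; rewrite /e; lra.
Qed.
End StarShaped.

(** * Straight-line maps *)

Section Meet.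
Variable R : realType.
Implicit Types a b c d e : 'rV[R]_3.

(** A converse to [hit_convex]. The five points have only one affine dependency up
    to a scalar, by Cramer's rule, and none of its coefficients vanishes. *)
Lemma meet_hit a b c d e (x y z u v : R) :
  vol b c d e != 0 -> vol a c d e != 0 -> vol a b d e != 0 -> vol a b c e != 0 ->
    vol a b c d != 0 ->
  0 <= x -> 0 <= y -> 0 <= z -> 0 <= u -> 0 <= v -> x + y + z = 1 -> u + v = 1 ->
  x *: a + y *: b + z *: c = u *: d + v *: e -> hit a b c d e.
Proof.
move=> n1 n2 n3 n4 n5 x0 y0 z0 u0 v0 xyz uv E.
have zE : z = 1 - x - y by rewrite -xyz; ring.
have vE : v = 1 - u by rewrite -uv; ring.
set p := x *: a + _ + _ in E.
have e2 : x * (- vol a c d e) = y * vol b c d e.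
  have h1 : vol p c d e = x * vol a c d e + y * vol b c d e by rewrite /p zE /vol !mxE;
    ring.
  have h2 : vol p c d e = 0 by rewrite E vE /vol !mxE; ring.
  by lra.
have e3 : x * vol a b d e = z * vol b c d e.
  have h1 : vol p b d e = x * vol a b d e - z * vol b c d e by rewrite /p zE /vol !mxE;
    ring.
  have h2 : vol p b d e = 0 by rewrite E vE /vol !mxE; ring.
  by lra.
have e4 : x * vol a b c e = u * vol b c d e.
  have h1 : vol p b c e = x * vol a b c e by rewrite /p zE /vol !mxE; ring.
  have h2 : vol p b c e = u * vol b c d e by rewrite E vE /vol !mxE; ring.
  by rewrite -h1 h2.
have e5 : x * (- vol a b c d) = v * vol b c d e.
  have h1 : vol p b c d = x * vol a b c d by rewrite /p zE /vol !mxE; ring.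
  have h2 : vol p b c d = - (v * vol b c d e) by rewrite E vE /vol !mxE; ring.
  by rewrite mulrN -h1 h2 opprK.
have xN0 : x != 0.
  apply/eqP => xz; move: e2 e3 xyz; rewrite xz !mul0r => /esym/eqP;
    rewrite mulf_eq0 (negbTE n1) orbF.
  by move=> /eqP-> /esym/eqP; rewrite mulf_eq0 (negbTE n1) orbF => /eqP->; lra.
have xp : 0 < x by rewrite lt_neqAle eq_sym xN0.
have pos w D : 0 <= w -> D != 0 -> x * D = w * vol b c d e ->
    (0 < D) = (0 < vol b c d e) /\ (D < 0) = (vol b c d e < 0).
  move=> w0 D0 xD; have wp : 0 < w.
    rewrite lt_neqAle w0 andbT eq_sym; apply/eqP => wz; move/eqP: xD.
    by rewrite wz mul0r mulf_eq0 (negbTE xN0) (negbTE D0).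
  by rewrite -(pmulr_rgt0 _ xp) -(pmulr_rlt0 _ xp) xD pmulr_rgt0// pmulr_rlt0.
have m2 : - vol a c d e != 0 by rewrite oppr_eq0.
have m5 : - vol a b c d != 0 by rewrite oppr_eq0.
have [p2 q2] := pos _ _ y0 m2 e2; have [p3 q3] := pos _ _ z0 n3 e3.
have [p4 q4] := pos _ _ u0 n4 e4; have [p5 q5] := pos _ _ v0 m5 e5.
rewrite /hit /same_sign /= p2 p3 p4 p5 q2 q3 q4 q5 !andbT !andbb.
by case: (ltrgtP 0 (vol b c d e)) n1.
Qed.

Lemma affine_last a b c d (x y z t : R) : vol a b c d != 0 ->
  x + y + z + t = 0 -> x *: a + y *: b + z *: c + t *: d = 0 -> t = 0.
Proof.
move=> v0 s0 E; have xE : x = - y - z - t by lra.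
have coord i : y * (b ord0 i - a ord0 i) + z * (c ord0 i - a ord0 i) + t * (d ord0 i - a
  ord0 i) = 0.
  by have := congr1 (fun w : 'rV[R]_3 => w ord0 i) E; rewrite !mxE xE => <-; ring.
pose w (i j : 'I_3) := (b ord0 i - a ord0 i) * (c ord0 j - a ord0 j)
  - (b ord0 j - a ord0 j) * (c ord0 i - a ord0 i).
pose e i := y * (b ord0 i - a ord0 i) + z * (c ord0 i - a ord0 i) + t * (d ord0 i - a ord0
  i).
have tv : t * vol a b c d = e o0 * w o1 o2 - e o1 * w o0 o2 + e o2 * w o0 o1.
  by rewrite /e /w /vol; ring.
move/eqP: tv; rewrite /e !coord !mul0r subr0 addr0 mulf_eq0 (negbTE v0) orbF.
by move/eqP.
Qed.

Lemma affinely_independent a b c d (x y z t : R) : vol a b c d != 0 ->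
  x + y + z + t = 0 -> x *: a + y *: b + z *: c + t *: d = 0 ->
  [/\ x = 0, y = 0, z = 0 & t = 0].
Proof.
move=> v0 s0 E; split; last exact: affine_last v0 s0 E.
- apply: (@affine_last b c d a y z t x); last by rewrite -E; apply/rowP => i;
  rewrite !mxE; ring.
    by have -> : vol b c d a = - vol a b c d by [rewrite /vol; ring]; rewrite oppr_eq0.
  by lra.
- apply: (@affine_last a c d b x z t y); last by rewrite -E; apply/rowP => i;
  rewrite !mxE; ring.
    by have -> : vol a c d b = vol a b c d by rewrite /vol; ring.
  by lra.
- apply: (@affine_last a b d c x y t z); last by rewrite -E; apply/rowP => i;
  rewrite !mxE; ring.
    by have -> : vol a b d c = - vol a b c d by [rewrite /vol; ring]; rewrite oppr_eq0.
  by lra.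
Qed.
End Meet.

Section Supports.
Variables (R : realType) (V : lmodType R).

Lemma sum_support (M : nmodType) (n : nat) (s : seq 'I_n) (F : 'I_n -> M) : uniq s ->
  (forall i, i \notin s -> F i = 0) -> \sum_i F i = \sum_(i <- s) F i.
Proof.
move=> us F0; rewrite (bigID (mem s)) /= [X in _ + X]big1 ?addr0; last by move=> i /F0.
by rewrite big_uniq.
Qed.

Variables (n : nat) (q : 'I_n -> V).
Implicit Types x y : 'rV[R]_n.

(** In barycentric coordinates a straight-line drawing is the restriction of a linear
    map. *)
Definition straight (x : 'rV[R]_n) : V := \sum_i x ord0 i *: q i.

Lemma straight_support (s : seq 'I_n) x : uniq s -> (forall i, x ord0 i != 0 -> i \in s) ->
  straight x = \sum_(i <- s) x ord0 i *: q i.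
Proof.
move=> us xs; apply: sum_support => // i si.
by rewrite (_ : x ord0 i = 0) ?scale0r//; apply/eqP; apply: contraNT si => /xs.
Qed.

Lemma coord_support (s : seq 'I_n) (x : 'rV[R]_n) : uniq s -> (forall i, x ord0 i != 0 ->
  i \in s) ->
  \sum_i x ord0 i = \sum_(i <- s) x ord0 i.
Proof.
move=> us xs; apply: sum_support => // i si.
by apply/eqP; apply: contraNT si => /xs.
Qed.

Lemma straightB x y : straight (x - y) = straight x - straight y.
Proof. by rewrite /straight -sumrB; apply: eq_bigr => i _; rewrite !mxE scalerBl. Qed.

Lemma straight_comb x y (s : R) :
  straight ((1 - s) *: x + s *: y) = (1 - s) *: straight x + s *: straight y.
Proof.
rewrite /straight !scaler_sumr -big_split; apply: eq_bigr => i _.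
by rewrite !mxE [LHS]scalerDl !scalerA.
Qed.

Lemma straight_vertex i : straight (delta_mx ord0 i) = q i.
Proof.
rewrite (@straight_support [:: i]) //; first by rewrite big_seq1 mxE !eqxx scale1r.
by move=> j; rewrite mxE inE eqxx /=; case: (j == i); rewrite // eqxx.
Qed.

Lemma straight_on_edge i j t : straight (on_edge i j t) = (1 - t) *: q i + t *: q j.
Proof. by rewrite straight_comb !straight_vertex. Qed.
End Supports.

Lemma straight_continuous (R : realType) (n : nat) (q : 'I_n ->
  'rV[R]_3) : continuous (straight q).
Proof.
apply: continuous_big => [|i _]; first exact: add_continuous.
by move=> x; apply: (@continuousZr_tmp _ _ _ (fun y : 'rV[R]_n => y ord0 i));
  exact: coord_continuous.
Qed.

(** * A straight-line drawing with nine links *)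

Definition zpoint := (int * int * int)%type.

Definition zvol (a b c d : zpoint) : int :=
  let x1 := b.1.1 - a.1.1 in let x2 := b.1.2 - a.1.2 in let x3 := b.2 - a.2 in
  let y1 := c.1.1 - a.1.1 in let y2 := c.1.2 - a.1.2 in let y3 := c.2 - a.2 in
  let z1 := d.1.1 - a.1.1 in let z2 := d.1.2 - a.1.2 in let z3 := d.2 - a.2 in
  x1 * (y2 * z3 - y3 * z2) - x2 * (y1 * z3 - y3 * z1) + x3 * (y1 * z2 - y2 * z1).

(** With straight edges these points have nine linked pairs of cycles, and the other
    pairs satisfy [unlinked]. *)
Definition example (i : nat) : zpoint := nth (0, 0, 0)
  [:: (-1, 3, 3); (3, -2, -1); (-1, 3, -2); (3, 2, 3); (3, -3, 1); (0, 0, -1); (-2, -2,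
    3)] i.

Definition zv (i j k l : nat) : int := zvol (example i) (example j) (example k) (example l).

Definition zhit (a b c d e : nat) : bool :=
  let s := [:: zv b c d e; - zv a c d e; zv a b d e; zv a b c e; - zv a b c d] in
  all (fun x => 0 < x) s || all (fun x => x < 0) s.

(** The triangles cut from a polygon by the diagonals through its first vertex. *)
Definition fan (s : seq nat) : seq (seq nat) :=
  if s is x :: s' then [seq [:: x; y.1; y.2] | y <- zip s' (behead s')] else [::].

Definition fan_misses (s t : seq nat) : bool :=
  all (fun u => all (fun e => ~~ zhit (nth 0%N u 0) (nth 0%N u 1) (nth 0%N u 2) e.1 e.2)
    (cycle_edges t)) (fan s).

(** A quadrilateral bounds two fans, one for each diagonal. *)
Definition unlinked (s t : seq nat) : bool :=
  [|| fan_misses s t, fan_misses (rot 1 s) t, fan_misses t s | fan_misses (rot 1 t) s].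

Definition linked_pairs := [seq st <- all_pairs | ~~ unlinked st.1 st.2].


Definition fan_ok (s : seq nat) : bool :=
  [&& fan s != [::], all (fun u => [&& size u == 3%N, uniq u, head 0%N s \in u &
        all (fun x => x \in s) u]) (fan s) &
      all (fun e => has (fun u => (e.1 \in u) && (e.2 \in u)) (fan s)) (cycle_edges s)].

Definition short_cycles := cycles 3 ++ cycles 4.

Lemma example_generic : all (fun i => all (fun j => all (fun k => all (fun l =>
   uniq [:: i; j; k; l] ==> (zv i j k l != 0)) (iota 0 7)) (iota 0 7)) (iota 0 7)) (iota 0
     7).
Proof. by vm_compute. Qed.

(* The local definitions let each list be computed only once. *)
Lemma pairs_listed : let l := all_pairs in let c := short_cycles in
  all (fun s => all (fun t => uniq (s ++ t) ==> ((s, t) \in l) || ((t, s) \in l)) c) c.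
Proof. by vm_compute. Qed.

Lemma normalize_cycle : let c := short_cycles in
  all (fun s => uniq s && cycle joined s ==>
    has (fun s' => same_edges s s' && same_edges s' s) c) (words 3 ++ words 4).
Proof. by vm_compute. Qed.

(** Four distinct vertices among which the given ones are found: enough to compare
    two points that lie on edges. *)
Definition extend4 (i j k l : nat) : seq nat :=
  let s := undup [:: i; j; k; l] in s ++ take (4 - size s) [seq x <- iota 0 7 | x \notin s].

Lemma extend4_ok : all (fun i => all (fun j => all (fun k => all (fun l =>
   let s := extend4 i j k l in [&& uniq s, size s == 4%N, all (fun x => x < 7)%N s,
     i \in s, j \in s, k \in s & l \in s]) (iota 0 7)) (iota 0 7)) (iota 0 7)) (iota 0 7).
Proof. by vm_compute. Qed.

Lemma short_cycles_ok : all (fun s => [&& uniq s, cycle joined s, below7 s, (2 < size s)%N,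
  fan_ok s & fan_ok (rot 1 s)]) short_cycles.
Proof. by vm_compute. Qed.

Lemma vertices_uniq s : below7 s -> uniq s -> uniq (vertices s).
Proof. by move=> s7 us; rewrite -(map_inj_uniq val_inj) verticesK. Qed.

Lemma cycle_of_rot s : below7 s -> uniq s -> cycle_of (rot 1 s) = cycle_of s.
Proof.
move=> s7 us; have r7 : below7 (rot 1 s).
  by apply/allP => x; rewrite mem_rot => /(allP s7).
apply: cycle_of_eq; rewrite ?rot_uniq// => e.
rewrite /cycle_edges (eq_map (g := fun x => ordered_edge x (next s x))).
  by rewrite map_rot mem_rot.
by move=> x; rewrite (next_rot 1 us).
Qed.

Lemma split_link_sym (R : realType) (L M : set 'rV[R]_3) : split_link L M -> split_link M L.
Proof.
move=> [S [tS LS MS sep]]; exists S; split=> // x y Mx Ly /connected_component_sym.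
exact: sep.
Qed.

Section Example.
Variable R : realType.

Definition zrow (c : zpoint) : 'rV[int]_3 := \row_i nth 0 [:: c.1.1; c.1.2; c.2] i.

Definition real_point (c : zpoint) : 'rV[R]_3 := map_mx intr (zrow c).

Lemma vol_real a b c d :
  vol (real_point a) (real_point b) (real_point c) (real_point d) = (zvol a b c d)%:~R.
Proof. by rewrite -vol_map /vol !mxE. Qed.

Definition corner (i : 'I_7) : 'rV[R]_3 := real_point (example i).

Definition example_map : 'rV[R]_7 -> 'rV[R]_3 := straight corner.

Lemma zhitE a b c d e : hit (real_point (example a)) (real_point (example b))
  (real_point (example c)) (real_point (example d)) (real_point (example e)) = zhit a b c
    d e.
Proof.
by rewrite /hit /same_sign /dependency /zhit /zv !vol_real /= -!rmorphN !ltr0z !ltrz0.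
Qed.

Lemma corner_generic (i j k l : nat) : below7 [:: i; j; k; l] -> uniq [:: i; j; k; l] ->
  vol (real_point (example i)) (real_point (example j)) (real_point (example k))
    (real_point (example l)) != 0.
Proof.
move=> /and5P[i7 j7 k7 l7 _] u; rewrite vol_real intr_eq0.
have m x : (x < 7)%N -> x \in iota 0 7 by rewrite mem_iota.
have /allP/(_ _ (m i i7))/allP/(_ _ (m j j7))/allP/(_ _ (m k k7))/allP/(_ _ (m l l7)) :=
  example_generic.
by rewrite u.
Qed.

(** The triangles of a fan, as simplices, so that the fan is the image of a
    realization. *)
Definition disc (s : seq nat) : {set {set 'I_7}} :=
  [set S in [seq [set i in vertices u]%SET | u <- fan s]]%SET.

Lemma realization_comb n (K : {set {set 'I_n}}) (S : {set 'I_n}) (i : 'I_n) (x : 'rV[R]_n)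
  (t : R) :
  S \in K -> i \in S -> (forall j, 0 <= x ord0 j) -> \sum_j x ord0 j = 1 ->
  (forall j, x ord0 j != 0 -> j \in S) -> 0 <= t <= 1 ->
  realization K ((1 - t) *: delta_mx ord0 i + t *: x).
Proof.
move=> SK iS x0 x1 xS /andP[t0 t1]; split.
- by move=> j; rewrite !mxE addr_ge0// mulr_ge0// ?ler0n//; lra.
- under eq_bigr do rewrite !mxE eqxx /=.
  have d : \sum_j (j == i)%:R = 1 :> R.
    by rewrite (bigD1 i)//= eqxx big1 ?addr0// => j /negbTE->.
  by rewrite big_split /= -!mulr_sumr x1 d; lra.
- exists S => // j; rewrite !mxE eqxx /=; apply: contra_neqT => jS.
  have -> : x ord0 j = 0 by apply/eqP; apply: contraNT jS => /xS.
  by case: eqP jS => [->|_ _]; rewrite ?iS// !mulr0 addr0.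
Qed.

(** If the other cycle met the fan, an edge would meet a triangle with five distinct
    corners. *)
Lemma fan_split s t : below7 s -> below7 t -> uniq (s ++ t) -> (1 < size t)%N -> fan_ok s ->
  fan_misses s t ->
  split_link (cycle_image example_map s) (cycle_image example_map t).
Proof.
move=> s7 t7 ust t1 /and3P[fan0 /allP fan3 /allP fane] miss.
have := ust; rewrite cat_uniq => /and3P[us /hasPn st ut].
have cf : continuous example_map by exact: straight_continuous.
have discP S : S \in disc s -> exists2 u, u \in fan s & S = [set i in vertices u]%SET.
  by rewrite inE => /mapP.
have inD u : u \in fan s -> [set i in vertices u]%SET \in disc s.
  by move=> us'; rewrite inE map_f.
have headS S : S \in disc s -> inord (head 0%N s) \in S.
  by move=> /discP[u /fan3/and4P[_ _ hu _] ->]; rewrite inE map_f.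
apply: (@split_star_shaped R (corner (inord (head 0%N s))) (example_map @` realization
  (disc s))).
- split.
    case: (fan s) fan0 inD => // u l _ /(_ u (mem_head _ _)) uD.
    exists (delta_mx ord0 (inord (head 0%N s))); last exact: straight_vertex.
    have := @realization_comb 7 (disc s) _ (inord (head 0%N s)) (delta_mx ord0 (inord
      (head 0%N s))) 0 uD (headS _ uD).
    rewrite subr0 scale1r scale0r addr0; apply; last by rewrite lexx ler01.
    + by move=> j; rewrite mxE ler0n.
    + rewrite (bigD1 (inord (head 0%N s)))//= mxE !eqxx big1 ?addr0// => j jh.
      by rewrite mxE (negbTE jh) andbF.
    + move=> j; rewrite mxE eqxx /=.
      have [->|_] := eqVneq j (inord (head 0%N s)); last by rewrite eqxx.
      by move=> _; exact: headS.
  move=> _ r [x [x0 x1 [S SD xS]] <-] r01.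
  exists ((1 - r) *: delta_mx ord0 (inord (head 0%N s)) + r *: x).
    by apply: (realization_comb SD (headS S SD)).
  by rewrite /example_map straight_comb straight_vertex.
- by apply: continuous_compact; [exact: continuous_subspaceT|exact: realization_compact].
- apply: compact_closed; first exact: norm_hausdorff.
  by apply: continuous_compact; [exact: continuous_subspaceT|exact: realization_compact].
- move=> _ [x [x0 x1 [S SC xS]] <-]; exists x => //; split=> //.
  case/(mem_cycle_of S s7 us): SC => e es SE.
  have /hasP[u uf /andP[e1 e2]] := fane e es.
  exists [set i in vertices u]%SET; first exact: inD.
  by move=> i /xS; rewrite SE !inE => /orP[]/eqP->; rewrite map_f.
rewrite -subset0 => _ [[x [x0 x1 [S /discP[u uf ->] xS]] <-] [y [y0 y1 [S' S'C yS]] E]].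
case/(mem_cycle_of S' t7 ut): S'C => e et S'E.
case/and4P: (fan3 u uf) => u3 uu _ /allP us'.
case: u u3 uf uu us' xS => [//|a [//|b [//|c [|//]]]] _ uf uu us' xS.
have [d7 e7] := cycle_edges_dom t7 et; have /andP[dt et'] := cycle_edges_mem et.
have de := cycle_edges_neq ut t1 et.
have in7 z : z \in [:: a; b; c] -> (z < 7)%N by move/us'/(allP s7).
have [a7 b7 c7] : [/\ a < 7, b < 7 & c < 7]%N by split; apply: in7; rewrite !inE eqxx ?orbT.
have sep z w : z \in [:: a; b; c] -> w \in t -> z != w.
  by move=> zu wt; apply: contraTneq wt => <-; apply/negP => /st; rewrite /= us'.
have u5 : uniq [:: a; b; c; e.1; e.2].
  move: uu; rewrite /= !inE !negb_or !andbT => /andP[/andP[ab ac] bc].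
  by rewrite ab ac bc de !sep// !inE eqxx ?orbT.
have u4 m : uniq (mask m [:: a; b; c; e.1; e.2]) := mask_uniq u5 m.
have b4 m : below7 (mask m [:: a; b; c; e.1; e.2]).
  by apply/allP => z /mem_mask; rewrite !inE => /or4P[/eqP->|/eqP->|/eqP->|/orP[]/eqP->].
have cE z : (z < 7)%N -> corner (inord z) = real_point (example z) by move=> z7;
  rewrite /corner inordK.
have ux : uniq (vertices [:: a; b; c]) by apply: vertices_uniq => //=; rewrite a7 b7 c7.
have uy : uniq (vertices [:: e.1; e.2]) by apply: vertices_uniq;
  rewrite /= ?d7 ?e7 ?inE ?de.
have xS' i : x ord0 i != 0 -> i \in vertices [:: a; b; c] by move=> /xS; rewrite inE.
have yS' i : y ord0 i != 0 -> i \in vertices [:: e.1; e.2].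
  by move=> /yS; rewrite S'E !inE.
have : hit (real_point (example a)) (real_point (example b)) (real_point (example c))
    (real_point (example e.1)) (real_point (example e.2)).
  apply: (@meet_hit R _ _ _ _ _ (x ord0 (inord a)) (x ord0 (inord b)) (x ord0 (inord c))
    (y ord0 (inord e.1)) (y ord0 (inord e.2))) => //.
  - exact: (corner_generic (b4 [:: false; true; true; true; true]) (u4 [:: false; true;
    true; true; true])).
  - exact: (corner_generic (b4 [:: true; false; true; true; true]) (u4 [:: true; false;
    true; true; true])).
  - exact: (corner_generic (b4 [:: true; true; false; true; true]) (u4 [:: true; true;
    false; true; true])).
  - exact: (corner_generic (b4 [:: true; true; true; false; true]) (u4 [:: true; true;
    true; false; true])).
  - exact: (corner_generic (b4 [:: true; true; true; true; false]) (u4 [:: true; true;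
    true; true; false])).
  - by move: x1; rewrite (coord_support ux xS') /= !big_cons big_nil addr0 addrA.
  - by move: y1; rewrite (coord_support uy yS') /= !big_cons big_nil addr0.
  - move: E; rewrite /example_map (straight_support _ ux xS') (straight_support _ uy yS')
    /=.
    by rewrite !big_cons !big_nil !addr0 !cE// addrA => ->.
rewrite zhitE; apply/negP.
exact: (allP (allP miss _ uf) _ et).
Qed.
End Example.

Section Upper.
Variable R : realType.
Let f := @example_map R.

Lemma unlinked_split s t : s \in short_cycles -> t \in short_cycles -> uniq (s ++ t) ->
  unlinked s t -> split_link (cycle_image f s) (cycle_image f t).
Proof.
have /allP ok := short_cycles_ok; move=> /ok/and5P[us js s7 s2 /andP[os ors]] /ok/and5P[ut
  jt t7 t2 /andP[ot ort]] ust.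
have rot7 u : below7 u -> below7 (rot 1 u) by move=> u7; apply/allP => x;
  rewrite mem_rot => /(allP u7).
have uts : uniq (t ++ s) by rewrite uniq_catC.
have rotc u v : uniq (u ++ v) -> uniq (rot 1 u ++ v).
  rewrite (cat_uniq u) (cat_uniq (rot 1 u)) rot_uniq => /and3P[-> h ->]; rewrite andbT.
  by apply: contra h => /hasP[x xv xu]; apply/hasP; exists x; rewrite // -(mem_rot 1).
have ci u : below7 u -> uniq u -> cycle_image f (rot 1 u) = cycle_image f u.
  by move=> u7 uu; rewrite /cycle_image cycle_of_rot.
rewrite /unlinked => /or4P[m|m|m|m].
- by apply: fan_split => //; exact: ltnW.
- by rewrite -ci//; apply: fan_split; [exact: rot7|by []|exact: rotc|exact: ltnW|by []|by
  []].
- by apply/split_link_sym; apply: fan_split => //; exact: ltnW.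
- by apply/split_link_sym; rewrite -(ci t)//; apply: fan_split;
  [exact: rot7|by []|exact: rotc|exact: ltnW|by []|by []].
Qed.

Lemma words_mem s : below7 s -> s \in words (size s).
Proof.
elim: s => [|x s IH] // /andP[x7 /IH ws].
have -> : words (size (x :: s)) = [seq y :: u | y <- iota 0 7, u <- words (size s)] by [].
by apply/allpairsP; exists (x, s); rewrite mem_iota.
Qed.

Lemma cycle_normal_form (s : seq 'I_7) : uniq s -> cycle K211111 s -> (2 < size s < 5)%N ->
  exists2 u, u \in short_cycles & edges_of_seq s = cycle_of u.
Proof.
move=> us cs s35; pose v := map val s.
have v7 : below7 v := below7_map s.
have uv : uniq v by rewrite (map_inj_uniq val_inj).
have cv : cycle joined v by rewrite cycle_map; apply: sub_cycle cs => x y /=;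
  rewrite K211111E.
have vw : v \in words 3 ++ words 4.
  have := words_mem v7; rewrite size_map mem_cat.
  by case: (size s) s35 => [|[|[|[|[|]]]]]// _ ->; rewrite ?orbT.
have /allP/(_ v vw) := normalize_cycle; rewrite uv cv => /hasP[u uc /andP[/allP vu /allP
  uv']].
exists u => //; have /allP/(_ u uc)/and5P[uu _ u7 _ _] := short_cycles_ok.
have -> : edges_of_seq s = cycle_of v by rewrite /cycle_of map_valK.
by apply: cycle_of_eq => // e; apply/idP/idP; [exact: vu|exact: uv'].
Qed.

Lemma link_listed P : is_link K211111 f P -> P \in [seq pair_of st | st <- linked_pairs].
Proof.
move=> [C [D [[s [s2 /andP[cs us] ->]] [t [t2 /andP[ct ut] ->]] disj -> ns]]].
have cov (u : seq 'I_7) x : x \in u -> x \in finset.cover (edges_of_seq u).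
  by move=> xu; apply/bigcupP; exists [set x; next u x]%SET; [apply: imset_f|rewrite !inE
    eqxx].
have dj : uniq (s ++ t).
  rewrite cat_uniq us ut andbT; apply/hasPn => x xt; apply/negP => xs.
  have : x \in (finset.cover (edges_of_seq s) :&: finset.cover (edges_of_seq t))%SET by
    rewrite inE !cov.
  by rewrite disj inE.
have := max_card (mem (s ++ t)); rewrite card_ord (card_uniqP dj) size_cat => st7.
have [s5 t5] : (2 < size s < 5)%N /\ (2 < size t < 5)%N.
  by move: s2 t2 st7; move: (size s) (size t) => a b; clear; lia.
have [u uc uE] := cycle_normal_form us cs s5; have [v vc vE] := cycle_normal_form ut ct t5.
have /allP ok := short_cycles_ok.
have /and5P[uu _ u7 _ _] := ok u uc; have /and5P[uv _ v7 _ _] := ok v vc.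
have ujv : uniq (u ++ v).
  rewrite cat_uniq uu uv andbT; apply/hasPn => x xv; apply/negP => xu.
  have inc w : below7 w -> x \in w -> inord x \in finset.cover (cycle_of w).
    by move=> w7 xw; rewrite cover_cycle_of inE map_f.
  have : (inord x : 'I_7) \in (finset.cover (edges_of_seq s) :&: finset.cover
    (edges_of_seq t))%SET.
    by rewrite inE uE vE !inc.
  by rewrite disj inE.
have nuv : ~~ unlinked u v.
  by apply/negP => /(unlinked_split uc vc ujv); rewrite /cycle_image -uE -vE.
have /allP/(_ u uc)/allP/(_ v vc) := pairs_listed; rewrite ujv uE vE => /orP[uvl|vul];
  apply/mapP.
  by exists (u, v); [rewrite mem_filter nuv; exact: uvl|].
exists (v, u); last by rewrite /pair_of /= finset.setUC.
rewrite mem_filter vul andbT /=; apply: contra nuv.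
by rewrite /unlinked => /or4P[]->; rewrite ?orbT.
Qed.

Lemma link_count_example : (link_count K211111 f <= 9)%N.
Proof.
have l9 : size [seq pair_of st | st <- linked_pairs] = 9%N by rewrite size_map; vm_compute.
move: l9 link_listed; move: [seq pair_of st | st <- linked_pairs] => l l9 listed.
rewrite -l9 /link_count; apply: leq_trans (card_size l); apply: subset_leq_card.
by apply/fintype.subsetP => P; rewrite inE => /asboolP/listed.
Qed.

Lemma simplices_pair S : S \in simplices K211111 -> exists i j : 'I_7, S = [set i; j]%SET.
Proof. by move=> /imsetP[[i j] _ ->]; exists i, j. Qed.

(** Two points on edges involve at most four vertices, which are affinely
    independent. *)
Lemma example_inj : set_inj (realization (simplices K211111)) f.
Proof.
move=> x y; rewrite !inE => -[x0 x1 [S /simplices_pair[i [j ->]] xS]] [y0 y1 [S'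
  /simplices_pair[k [l ->]] yS]] E.
have m (h : 'I_7) : val h \in iota 0 7 by rewrite mem_iota ltn_ord.
have /allP/(_ _ (m i))/allP/(_ _ (m j))/allP/(_ _ (m k))/allP/(_ _ (m l)) := extend4_ok.
move: (extend4 i j k l) => v /and5P[u v4 b7 ia /and3P[ja ka la]].
case: v v4 u b7 ia ja ka la => [|a [|b [|c [|d [|? ?]]]]]// _ u b7 ia ja ka la.
pose w := x - y; have w0 : straight (@corner R) w = 0.
  by rewrite straightB; apply/eqP; rewrite subr_eq0; apply/eqP.
have ws h : w ord0 h != 0 -> h \in vertices [:: a; b; c; d].
  have hm (z : 'I_7) : val z \in [:: a; b; c; d] -> z \in vertices [:: a; b; c; d].
    by move=> zi; rewrite -(inord_val z) map_f.
  rewrite !mxE; have [hx|hx] := eqVneq (x ord0 h) 0.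
    have [hy|hy] := eqVneq (y ord0 h) 0; first by rewrite hx hy subrr eqxx.
    by case/finset.set2P: (yS h hy) => -> _; apply: hm.
  by case/finset.set2P: (xS h hx) => -> _; apply: hm.
have uv : uniq (vertices [:: a; b; c; d]) := vertices_uniq b7 u.
have sum0 : \sum_h w ord0 h = 0.
  by under eq_bigr do rewrite !mxE; rewrite sumrB x1 y1 subrr.
move: w0 sum0; rewrite (straight_support _ uv ws) (coord_support uv ws) /= !big_cons
  !big_nil !addr0 => w0 sum0.
have cE z : z \in [:: a; b; c; d] -> corner R (inord z) = real_point R (example z).
  by move=> /(allP b7) z7; rewrite /corner inordK.
rewrite !cE ?inE ?eqxx ?orbT// in w0.
have [] := affinely_independent (corner_generic R b7 u) (x := w ord0 (inord a))
  (y := w ord0 (inord b)) (z := w ord0 (inord c)) (t := w ord0 (inord d)).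
- by rewrite -!addrA.
- by rewrite -!addrA.
move=> wa wb wc wd; apply/eqP; rewrite -subr_eq0; apply/eqP/rowP => h; rewrite [RHS]mxE.
apply: contrapT => /eqP wh; have := ws h wh.
rewrite !inE => /or4P[]/eqP hE; move: wh; rewrite hE -/w;
  by rewrite ?wa ?wb ?wc ?wd eqxx.
Qed.

Lemma edge_image (i j : 'I_7) : i != j ->
  f @` realization [set [set i; j]%SET]%SET = segment (corner R i) (corner R j).
Proof.
move=> ij; apply/seteqP; split=> [_ [x [x0 x1 [S SE xS]] <-]|_ [t /= t01 <-]].
  move: SE; rewrite inE => /eqP SE; rewrite SE in xS.
  have us : uniq [:: i; j] by rewrite /= inE ij.
  have xS' h : x ord0 h != 0 -> h \in [:: i; j] by move=> /xS; rewrite !inE.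
  move: x1; rewrite (coord_support us xS') !big_cons big_nil addr0 => xij.
  exists (x ord0 j); first by rewrite /= x0 -xij lerDr x0.
  rewrite /f /example_map (straight_support _ us xS') !big_cons big_nil addr0.
  by rewrite (_ : 1 - x ord0 j = x ord0 i)// -xij addrK.
exists (on_edge i j t); last exact: straight_on_edge.
by apply: realization_on_edge; rewrite ?inE.
Qed.

Lemma example_tame : tame_embedding K211111 f.
Proof.
split.
- exact/continuous_subspaceT/straight_continuous.
- exact: example_inj.
- exists id.
    by split; [move=> x A|exists id; split => // x A].
  move=> i j eij; rewrite image_id edge_image; last first.
    by apply: contraTneq eij => ->; rewrite K211111E /joined eqxx.
  exists [:: corner R i; corner R j]; apply/seteqP; split=> [x sx|x [[|k] /=]//].
  by exists 0%N.
Qed.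
End Upper.

Theorem mnl_K211111 (R : realType) : mnl R K211111 = 9%N.
Proof.
have ex : link_count K211111 (@example_map R) = 9%N.
  apply/eqP; rewrite eqn_leq link_count_example nine_links//.
  by have [] := @example_tame R.
rewrite /mnl; case: xgetP => [m -> [[f tf fm] mmin]|/(_ 9%N) []].
  apply/eqP; rewrite eqn_leq; apply/andP; split.
    by rewrite -[X in (_ <= X)%N]ex; apply: mmin; exact: example_tame.
  by rewrite -fm; apply: nine_links; case: tf.
split; first by exists (@example_map R) => //; exact: example_tame.
by move=> f [cf _ _]; exact: nine_links.
Qed.

Theorem proposition8 (R : realType) :
  mnl R (complete_multipartite [:: 2; 1; 1; 1; 1; 1]%N) = 9%N.
Proof. exact: mnl_K211111. Qed.
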